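(* Let $a,b,c>0$ and let $g_0:\overline{\mathbb{R}_+^2}\to\mathbb{R}$ be positive, bounded and Lipschitz continuous. Let $I$ be the upper value function $$I(\mathbf{x},t)=\sup_{\theta\in\Theta}\ \inf_{(\gamma,\eta,l)\in\mathbb{Y}^{\mathbf{x},t}}\left\{\int_0^{t\wedge\theta[\gamma]}\big(L(-\eta(\tau))+F(\gamma,\eta,l)(\tau)\big)\,d\tau+\chi_{\{\theta[\gamma]=t\}}\,g_0(\gamma(t))\right\},\qquad(\mathbf{x},t)\in\overline{\mathbb{R}_+^2}\times\mathbb{R}_+ .$$ Then $I$ is continuous on $\overline{\mathbb{R}_+^2}\times\mathbb{R}_+$ and is a viscosity solution of $$\begin{cases}\min\{v_t+|\nabla v|^2+c\,v_x+1,\ v\}=0, & x\in\mathbb{R},\ y>0,\ t\in\mathbb{R}_+,\\ a v_x^2-v_y+b v_x=0, & x\in\mathbb{R},\ y=0,\ t\in\mathbb{R}_+,\\ v(x,y,0)=g_0(x,y), & (x,y)\in\overline{\mathbb{R}_+^2}.\end{cases}$$ Moreover, $\lim_{t\to0^+}I(\mathbf{x},t)=g_0(\mathbf{x})$ for every $\mathbf{x}\in\overline{\mathbb{R}_+^2}$.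
   Context: Notation: $\mathbb{R}_+=(0,\infty)$, $\mathbb{R}_+^2=\mathbb{R}\times\mathbb{R}_+$, $\overline{\mathbb{R}_+^2}=\mathbb{R}\times[0,\infty)$; $s\wedge t=\min\{s,t\}$; $\chi_A$ is the indicator of $A$. Lagrangian: for $q=(q_1,q_2)\in\mathbb{R}^2$, $L(q)=\frac{|q|^2}{4}-\frac{c}{2}q_1+\frac{c^2}{4}-1$, the Legendre transform of $H(p)=|p|^2+cp_1+1$. For $q_1\in\mathbb{R}$, $G(q_1)=\frac{(q_1-b)^2}{4a}$, the Legendre transform of $B(p_1)=ap_1^2+bp_1$. Control triplets: for $\mathbf{x}\in\overline{\mathbb{R}_+^2}$, $t>0$, $\mathbb{Y}^{\mathbf{x},t}$ is the set of triplets $(\gamma,\eta,l)$ with $\gamma=(\gamma_1,\gamma_2)$ absolutely continuous from $[0,t]$ to $\overline{\mathbb{R}_+^2}$, $\eta=(\eta_1,\eta_2)\in L^1([0,t],\mathbb{R}^2)$, $l\in L^1([0,t],\mathbb{R})$, such that: $\gamma(0)=\mathbf{x}$; for a.e. $\tau\in[0,t]$, $l(\tau)\ge0$, and $l(\tau)=0$ if $\gamma_2(\tau)\ne0$; the function $F(\gamma,\eta,l)(\tau):=l(\tau)\,G\big(\frac{\eta_1(\tau)-\dot\gamma_1(\tau)}{l(\tau)}\big)$ is integrable on $[0,t]$, where this expression means $\frac{(\eta_1-\dot\gamma_1-bl)^2(\tau)}{4a\,l(\tau)}$ if $l(\tau)>0$ and $0$ if $l(\tau)=0$; for a.e. $\tau$,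 $\dot\gamma(\tau)=\eta(\tau)$ if $l(\tau)=0$, and $\eta_2(\tau)=\dot\gamma_2(\tau)-l(\tau)$ if $l(\tau)\ne0$. Stopping times: $\Theta$ is the set of all maps $\theta:L^2([0,\infty);\overline{\mathbb{R}_+^2})\to[0,\infty)$ such that for all $\gamma,\hat\gamma$ and all $s\in[0,\infty)$: if $\gamma=\hat\gamma$ a.e. on $[0,s]$ and $\theta[\gamma]\le s$, then $\theta[\gamma]=\theta[\hat\gamma]$. For a path $\gamma$ defined only on $[0,t]$, $\theta[\gamma]$ is evaluated on any extension of $\gamma$ in $L^2([0,\infty);\overline{\mathbb{R}_+^2})$ (by the stopping-time property, $t\wedge\theta[\gamma]$ and whether $\theta[\gamma]=t$ do not depend on the extension). Viscosity solutions: write $\mathcal{T}[\phi]=\phi_t+|\nabla\phi|^2+c\phi_x+1$ and $\mathcal{B}[\phi]=a\phi_x^2-\phi_y+b\phi_x$; at $y=0$ values and derivatives of $\phi\in C^1(\overline{\mathbb{R}_+^2}\times\mathbb{R}_+)$ are one-sided (from $y>0$). An upper semicontinuous $\underline v$ on $\overline{\mathbb{R}_+^2}\times\mathbb{R}_+$ is a viscosity sub-solution if, for every $\phi\in C^1(\overline{\mathbb{R}_+^2}\times\mathbb{R}_+)$ such that $\underline v-\phi$ attains a strict maximum at $(x,y,t)\in\overline{\mathbb{R}_+^2}\times\mathbb{R}_+$ with $\underline v(x,y,t)>0$: $\mathcal{T}[\phi](x,y,t)\le0$ if $y\ne0$, and $\min\{\mathcal{T}[\phi](x,0,t),\mathcal{B}[\phi](x,0,t)\}\le0$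 if $y=0$. A lower semicontinuous $\bar v$ is a viscosity super-solution if $\bar v\ge0$ and, for every $\phi\in C^1(\overline{\mathbb{R}_+^2}\times\mathbb{R}_+)$ such that $\bar v-\phi$ attains a strict minimum at $(x,y,t)$: $\mathcal{T}[\phi](x,y,t)\ge0$ if $y\ne0$, and $\max\{\mathcal{T}[\phi](x,0,t),\mathcal{B}[\phi](x,0,t)\}\ge0$ if $y=0$. A viscosity solution is a function that is both. *)

(* Defs.v *)
From mathcomp Require Import all_boot all_order all_algebra.
From mathcomp Require Import all_classical all_reals all_analysis.

Set Implicit Arguments.
Unset Strict Implicit.
Unset Printing Implicit Defensive.

Import Order.TTheory GRing.Theory Num.Theory.
Import numFieldNormedType.Exports.

Local Open Scope classical_set_scope.
Local Open Scope ring_scope.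

(* R * R carries the max norm of the library, which is equivalent to the
   Euclidean one; where the Euclidean norm enters a formula it is written out. *)
Definition half_plane (R : realType) : set (R * R) := [set x | 0 <= x.2].

(* z = (x, y, t) with y >= 0 and t > 0 *)
Definition space_time (R : realType) : set (R * R * R) :=
  [set z | half_plane z.1 /\ 0 < z.2].
Arguments half_plane : clear implicits.
Arguments space_time : clear implicits.

Definition Lagrangian (R : realType) (c : R) (q : R * R) : R :=
  (q.1 ^+ 2 + q.2 ^+ 2) / 4 - c / 2 * q.1 + c ^+ 2 / 4 - 1.

Definition G (R : realType) (a b : R) (q : R) : R := (q - b) ^+ 2 / (4 * a).

Definition absolutely_continuous_on (R : realType) (V : normedModType R)
    (u v : R) (f : R -> V) : Prop :=
  forall e : R, 0 < e -> exists2 d : R, 0 < d &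
    forall (n : nat) (s r : 'I_n -> R),
      (forall i, u <= s i /\ s i <= r i /\ r i <= v) ->
      (forall i j, i != j -> r i <= s j \/ r j <= s i) ->
      \sum_(i < n) (r i - s i) < d ->
      \sum_(i < n) `|f (r i) - f (s i)| < e.

(* F(gamma, eta, l); the derivative exists almost everywhere along an
   absolutely continuous path, and only its values there matter. *)
Definition boundary_cost (R : realType) (a b : R)
    (gamma eta : R -> R * R) (l : R -> R) (s : R) : R :=
  if 0 < l s then l s * G a b (((eta s).1 - (derive1 gamma s).1) / l s) else 0.

(* The set Y^{x,t}. Elements of L^1([0,t]) are represented by functions on R,
   of which only the values on [0,t] are used. *)
Definition control (R : realType) (a b : R) (x : R * R) (t : R)
    (gamma eta : R -> R * R) (l : R -> R) : Prop :=
  let mu := @lebesgue_measure R in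
  [/\ absolutely_continuous_on 0 t gamma,
      forall s, 0 <= s <= t -> half_plane R (gamma s) &
      gamma 0 = x] /\
  [/\ mu.-integrable `[0, t] (fun s => (eta s).1%:E),
      mu.-integrable `[0, t] (fun s => (eta s).2%:E),
      mu.-integrable `[0, t] (fun s => (l s)%:E) &
      mu.-integrable `[0, t] (fun s => (boundary_cost a b gamma eta l s)%:E)] /\
  {ae mu, forall s, 0 <= s <= t ->
     [/\ 0 <= l s,
         (gamma s).2 <> 0 -> l s = 0,
         l s = 0 -> derive1 gamma s = eta s &
         l s <> 0 -> (eta s).2 = (derive1 gamma s).2 - l s]}.

(* L^2([0,oo); half_plane), as a set of representatives *)
Definition L2_path (R : realType) (gamma : R -> R * R) : Prop :=
  [/\ measurable_fun (`[0, +oo[ : set R) (fun s => (gamma s).1),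
      measurable_fun (`[0, +oo[ : set R) (fun s => (gamma s).2),
      (@lebesgue_measure R).-integrable `[0, +oo[
        (fun s => ((gamma s).1 ^+ 2 + (gamma s).2 ^+ 2)%:E) &
      forall s, 0 <= s -> half_plane R (gamma s)].

(* The set Theta. Taking s = theta gamma shows that theta takes the same value
   on representatives that are equal almost everywhere on [0,oo), hence is a
   map on L^2; its values outside L2_path are irrelevant. *)
Definition stopping_time (R : realType) (theta : (R -> R * R) -> R) : Prop :=
  (forall gamma, L2_path gamma -> 0 <= theta gamma) /\
  (forall gamma gamma' s, L2_path gamma -> L2_path gamma' -> 0 <= s ->
     {ae @lebesgue_measure R, forall r, 0 <= r <= s -> gamma r = gamma' r} ->
     theta gamma <= s -> theta gamma = theta gamma').

(* A path on [0,t] is extended by the origin after time t; by the next lemma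
   any other extension in L2_path leads to the same payoff. *)
Definition extend (R : realType) (t : R) (gamma : R -> R * R) : R -> R * R :=
  patch (cst (0, 0)) `[0, t] gamma.

Lemma stopping_time_extension (R : realType) (theta : (R -> R * R) -> R)
    (t : R) (gamma gamma' : R -> R * R) :
  stopping_time theta -> 0 <= t -> L2_path gamma -> L2_path gamma' ->
  {ae @lebesgue_measure R, forall r, 0 <= r <= t -> gamma r = gamma' r} ->
  Num.min t (theta gamma) = Num.min t (theta gamma') /\
  (theta gamma = t <-> theta gamma' = t).
Proof.
move=> [_ st] t0 g2 g2' gg'.
have g'g : {ae @lebesgue_measure R,
    forall r, 0 <= r <= t -> gamma' r = gamma r}.
  apply: negligibleS gg' => r /= ngr gr; apply: ngr => le_r.
  by rewrite gr.
case: (boolP (theta gamma <= t)) => [le1|].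
  by rewrite (st _ _ _ g2 g2' t0 gg' le1).
rewrite -ltNge => lt1; case: (boolP (theta gamma' <= t)) => [le2|].
  by move: lt1; rewrite -(st _ _ _ g2' g2 t0 g'g le2) ltNge le2.
rewrite -ltNge => lt2; rewrite !min_l ?ltW//; split=> //.
by split=> e; [rewrite e ltxx in lt1|rewrite e ltxx in lt2].
Qed.

(* For a > 0 the integrand is bounded below by -1, so that the integral is well defined
   in ]-oo, +oo]; it is +oo when eta is not square integrable there. *)
Definition payoff (R : realType) (a b c : R) (g0 : R * R -> R) (t : R)
    (theta : (R -> R * R) -> R) (gamma eta : R -> R * R) (l : R -> R) : \bar R :=
  let T := theta (extend t gamma) in
  ((\int[@lebesgue_measure R]_(s in `[0%R, Num.min t T])
      (Lagrangian c (- eta s) + boundary_cost a b gamma eta l s)%:E)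
   + (if T == t then g0 (gamma t) else 0)%:E)%E.

Definition upper_value (R : realType) (a b c : R) (g0 : R * R -> R)
    (x : R * R) (t : R) : \bar R :=
  ereal_sup [set V | exists theta, stopping_time theta /\
    V = ereal_inf [set p | exists gamma eta l,
          control a b x t gamma eta l /\
          p = payoff a b c g0 t theta gamma eta l]].

Definition dx (R : realType) (phi : R * R * R -> R) (z : R * R * R) : R :=
  derive1 (fun x => phi (x, z.1.2, z.2)) z.1.1.

Definition dt (R : realType) (phi : R * R * R -> R) (z : R * R * R) : R :=
  derive1 (fun t => phi (z.1.1, z.1.2, t)) z.2.

(* The increment h is restricted to y + h >= 0: the derivative is the usual
   one for y > 0 and the one-sided one for y = 0. *)
Definition dy_quotient (R : realType) (phi : R * R * R -> R) (z : R * R * R) :=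
  (fun h : R => h^-1 * (phi (z.1.1, z.1.2 + h, z.2) - phi z))
    @ within [set h : R | 0 <= z.1.2 + h] (0 : R)^'.

Definition dy (R : realType) (phi : R * R * R -> R) (z : R * R * R) : R :=
  lim (dy_quotient phi z).

Definition C1 (R : realType) (phi : R * R * R -> R) : Prop :=
  (forall z, space_time R z ->
     [/\ derivable (fun x => phi (x, z.1.2, z.2)) z.1.1 1,
         derivable (fun t => phi (z.1.1, z.1.2, t)) z.2 1 &
         cvg (dy_quotient phi z)]) /\
  [/\ {within space_time R, continuous phi},
      {within space_time R, continuous (dx phi)},
      {within space_time R, continuous (dy phi)} &
      {within space_time R, continuous (dt phi)}].

Definition interior_op (R : realType) (c : R) (phi : R * R * R -> R)
    (z : R * R * R) : R :=
  dt phi z + (dx phi z ^+ 2 + dy phi z ^+ 2) + c * dx phi z + 1.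

Definition boundary_op (R : realType) (a b : R) (phi : R * R * R -> R)
    (z : R * R * R) : R :=
  a * dx phi z ^+ 2 - dy phi z + b * dx phi z.

Definition strict_max_at (R : realType) (f : R * R * R -> R) (z : R * R * R) :=
  space_time R z /\ forall w, space_time R w -> w <> z -> f w < f z.

Definition strict_min_at (R : realType) (f : R * R * R -> R) (z : R * R * R) :=
  space_time R z /\ forall w, space_time R w -> w <> z -> f z < f w.

Definition viscosity_subsolution (R : realType) (a b c : R)
    (v : R * R * R -> R) : Prop :=
  lower_semicontinuous (fun z : subspace (space_time R) => (- v z)%:E) /\
  forall phi z, C1 phi -> strict_max_at (v - phi) z -> 0 < v z ->
    (z.1.2 != 0 -> interior_op c phi z <= 0) /\
    (z.1.2 = 0 -> Num.min (interior_op c phi z) (boundary_op a b phi z) <= 0).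

Definition viscosity_supersolution (R : realType) (a b c : R)
    (v : R * R * R -> R) : Prop :=
  [/\ lower_semicontinuous (fun z : subspace (space_time R) => (v z)%:E),
      forall z, space_time R z -> 0 <= v z &
      forall phi z, C1 phi -> strict_min_at (v - phi) z ->
        (z.1.2 != 0 -> 0 <= interior_op c phi z) /\
        (z.1.2 = 0 ->
           0 <= Num.max (interior_op c phi z) (boundary_op a b phi z))].

(* Viscosity solution of
     min {v_t + |Dv|^2 + c v_x + 1, v} = 0   for y > 0, t > 0,
     a v_x^2 - v_y + b v_x = 0               for y = 0, t > 0,
     v = g0                                  for t = 0. *)
Definition viscosity_solution (R : realType) (a b c : R) (g0 : R * R -> R)
    (v : R * R * R -> R) : Prop :=
  [/\ viscosity_subsolution a b c v,
      viscosity_supersolution a b c v &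
      forall x, half_plane R x -> v (x, 0) = g0 x].

(* Main.v *)
Require Import Defs.
From HB Require Import structures.
From mathcomp Require Import all_boot all_order all_algebra.
From mathcomp Require Import all_classical all_reals all_analysis.
From mathcomp Require Import measurable_realfun.
From mathcomp Require Import ring lra.

(* Write A(s) for the running cost of a control up to time s.  Taking the
   positive part commutes with taking infima, so the game value equals
     W(x, t) = inf over controls of sup_{s <= t} (A(s) + [s = t] g0(gamma(t))).
   One inequality is immediate.  For the other one, the maximizer stops at the
   first point of a fine time grid at which every choice of (eta, l) along the
   observed path has cost at least W - e; if this never happens, then choosing
   pointwise the cheapest of finitely many (eta, l) along the same path gives a
   control of value less than W.
   The basic estimate on controls is Fenchel duality: for a fixed vector P,
     A(h) + P.(gamma(h) - gamma(0)) >= - H(P) h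
   as soon as the path stays off the road or a P_1^2 + b P_1 - P_2 <= 0, and the
   same holds for all P with a worse constant.  It makes W Lipschitz continuous
   up to t = 0, and it gives the supersolution property by a first-order
   expansion of the test function at the contact point only.  The subsolution
   property is tested on controls with constant velocity.  The estimate needs
   the fundamental theorem of calculus for absolutely continuous functions,
   obtained here by applying Radon-Nikodym to the Lebesgue-Stieltjes measures of
   the variation. *)

Import Order.TTheory GRing.Theory Num.Theory.
Import numFieldNormedType.Exports.

Local Open Scope classical_set_scope.
Local Open Scope ring_scope.

Set Implicit Arguments.
Unset Strict Implicit.
Unset Printing Implicit Defensive.

(** * Absolute continuity and total variation *)

Section absolute_continuity.
Context {R : realType}.
Implicit Types (u v : R) (f g : R -> R) (s : seq (R * R)).
Local Notation mu := (@lebesgue_measure R).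

(** The maximizer observes [gamma] but not [(eta, l)], and on the road the same path can be driven
    by pairs of very different cost. Replacing pairs along a fixed path is possible because every
    constraint linking [(eta, l)] to [gamma] is pointwise: a measurable selection between two
    admissible pairs is admissible, and taking the cheaper one lowers all partial costs A(s) at
    once. Between grid times only the lower bound -1 of the integrand is available; it costs one
    mesh width. On the road the Fenchel inequality carries the extra term [- l * road P], unbounded
    below when [road P > 0]. But a path in the half plane has zero normal velocity almost everywhere
    on the road, so [eta_2 = - l] there, and the term [l^2 / 4] of the Lagrangian compensates. This
    is the origin of the worse constant, which contains [(a P_1^2 + b P_1)^2]. In the supersolution
    test velocities are not bounded, so an expansion error proportional to the displacement is not
    o(h). It is paid by the cost itself, through a small change of P. *)

Definition nonoverlapping : rel (R * R) :=
  fun p q => (p.2 <= q.1) || (q.2 <= p.1).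

(** Families are lists instead of the ordinal-indexed ones in [absolutely_continuous_on], because
    single intervals are going to be replaced in place by partitions. *)
Definition interval_family u v s :=
  all (fun p => [&& u <= p.1, p.1 <= p.2 & p.2 <= v]) s &&
  pairwise nonoverlapping s.

Definition family_length s := \sum_(p <- s) (p.2 - p.1).
Definition family_variation f s := \sum_(p <- s) `|f p.2 - f p.1|.

Definition ac_modulus u v f (e d : R) := forall s, interval_family u v s ->
  family_length s < d -> family_variation f s < e.

Lemma absolutely_continuous_modulus u v f :
  absolutely_continuous_on u v f ->
  forall e, 0 < e -> exists2 d, 0 < d & ac_modulus u v f e d.
Proof.
move=> acf e /acf[d d0 H]; exists d => // s /andP[/allP sb /(pairwiseP (0, 0)) sp].
rewrite /family_length /family_variation !(big_nth (0, 0)) !big_mkord.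
apply: (H (size s) (fun i => (nth (0, 0) s i).1) (fun i => (nth (0, 0) s i).2)).
  by move=> i; have /and3P[] := sb _ (mem_nth (0, 0) (ltn_ord i)).
move=> i j; rewrite neq_ltn => /orP[ij|ji].
  by have /orP[] := sp i j (ltn_ord _) (ltn_ord _) ij; [left|right].
by have /orP[] := sp j i (ltn_ord _) (ltn_ord _) ji; [right|left].
Qed.

Fixpoint partition_pairs (a : R) (l : seq R) : seq (R * R) :=
  if l is x :: l' then (a, x) :: partition_pairs x l' else [::].

Lemma partition_pairs_mem a b l p : itv_partition a b l ->
  p \in partition_pairs a l -> [/\ a <= p.1, p.1 <= p.2 & p.2 <= b].
Proof.
elim: l a => [|x l ih] a //= ip.
have xb := itv_partition_le (itv_partition_cons ip).
have ax : a < x by case: ip => /= /andP[].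
rewrite inE => /orP[/eqP ->|/(ih _ (itv_partition_cons ip))[xp pp pb]] /=.
  by split => //; exact: ltW.
by split => //; apply: le_trans xp; exact: ltW.
Qed.

Lemma partition_pairs_pairwise a b l : itv_partition a b l ->
  pairwise nonoverlapping (partition_pairs a l).
Proof.
elim: l a => [|x l ih] a //= ip; apply/andP; split; last first.
  exact: ih (itv_partition_cons ip).
apply/allP => p /(partition_pairs_mem (itv_partition_cons ip))[xp _ _].
by rewrite /nonoverlapping /= xp.
Qed.

Lemma partition_pairs_length a b l : itv_partition a b l ->
  family_length (partition_pairs a l) = b - a.
Proof.
rewrite /family_length; elim: l a => [|x l ih] a ip /=.
  by rewrite big_nil (itv_partition_nil ip) subrr.
rewrite big_cons (ih _ (itv_partition_cons ip)) /=; ring.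
Qed.

Lemma partition_pairs_variation a b f l : itv_partition a b l ->
  family_variation f (partition_pairs a l) = variation a b f l.
Proof.
move=> ip; rewrite (variation_zip _ ip) /family_variation.
elim: l a {ip} => [|x l ih] a /=; first by rewrite !big_nil.
by rewrite !big_cons ih.
Qed.

Lemma interval_family_refine u v s1 a b s2 l :
  interval_family u v (s1 ++ (a, b) :: s2) -> itv_partition a b l ->
  interval_family u v ((s1 ++ partition_pairs a l) ++ s2).
Proof.
move=> /andP[]; rewrite /interval_family !all_cat !pairwise_cat /=.
move=> /and3P[-> /and3P[/= ua ab bv] ->].
rewrite allrel_consr /= => /and3P[/andP[h1 h2] -> /andP[h3 h4]] ip.
rewrite h4 (partition_pairs_pairwise ip) !andbT /=.
apply/and3P; split.
- apply/allP => p /(partition_pairs_mem ip)[ap -> pb] /=.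
  by rewrite (le_trans ua)// (le_trans pb).
- rewrite allrel_catl h2 /=.
  apply/allrelP => p q /(partition_pairs_mem ip)[ap _ pb] qs.
  have /orP[/= bq|/= qa] := allP h3 _ qs; apply/orP; [left|right].
    exact: le_trans bq.
  exact: le_trans qa _.
- apply/allrelP => q p qs /(partition_pairs_mem ip)[ap _ pb].
  have /orP[/= qa|/= bq] := allP h1 _ qs; apply/orP; [left|right].
    exact: le_trans ap.
  exact: le_trans bq.
Qed.

End absolute_continuity.

Section total_variation_ac.
Context {R : realType}.
Implicit Types (u v : R) (f g : R -> R) (s : seq (R * R)).
Local Notation mu := (@lebesgue_measure R).

Lemma itv_partition_trivial (a b : R) : a <= b -> exists l, itv_partition a b l.
Proof.
rewrite le_eqVlt => /orP[/eqP ->|ab]; first by exists [::]; split.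
by exists [:: b]; exact: itv_partition1.
Qed.

Lemma family_length_cat s1 s2 :
  family_length (s1 ++ s2) = family_length s1 + family_length s2.
Proof. by rewrite /family_length big_cat. Qed.

Lemma family_variation_cat f s1 s2 :
  family_variation f (s1 ++ s2) = family_variation f s1 + family_variation f s2.
Proof. by rewrite /family_variation big_cat. Qed.

(* The intervals of [s2] are replaced one at a time by partitions, whose pairs
   join the family [s1]. *)
Lemma ac_modulus_total_variation u v f e d s1 s2 : ac_modulus u v f e d ->
  interval_family u v (s1 ++ s2) -> family_length (s1 ++ s2) < d ->
  ((family_variation f s1)%:E + \sum_(p <- s2) total_variation p.1 p.2 f
    <= e%:E)%E.
Proof.
move=> acf; elim: s2 s1 => [|[a b] s2 ih] s1.
  by rewrite cats0 big_nil adde0 lee_fin => i1 l1; exact/ltW/acf.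
move=> fam len; rewrite big_cons /=.
have ab : a <= b.
  by case/andP: fam; rewrite all_cat /= => /and3P[_ /and3P[]].
set Y := (\sum_(p <- s2) _)%E.
have Y0 : (0 <= Y)%E.
  rewrite /Y big_seq; apply: sume_ge0 => p ps2; apply: total_variation_ge0.
  case/andP: fam; rewrite all_cat /= => /and3P[_ _ /allP/(_ _ ps2)].
  by case/and3P.
have key l : itv_partition a b l ->
    ((family_variation f s1 + variation a b f l)%:E + Y <= e%:E)%E.
  move=> ip; rewrite -(partition_pairs_variation f ip) -family_variation_cat.
  apply: ih; first exact: interval_family_refine fam ip.
  move: len; rewrite !family_length_cat (partition_pairs_length ip).
  by rewrite /family_length big_cons /= addrA.
(* The trivial partition of [[a, b]] already bounds [Y] by a real, so [Y] can be moved to the other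
   side before the supremum over partitions is taken. *)
have Yfin : Y \is a fin_num.
  have [l /key H] := itv_partition_trivial ab.
  by rewrite ge0_fin_numE//; move: H Y0; case: (Y) => //= r; rewrite ltry.
rewrite addeCA -leeBrDr ?fin_numD ?Yfin//.
apply: ge_ereal_sup => _ [_ [l ip <-] <-].
rewrite leeBrDr ?fin_numD ?Yfin// addeA -EFinD (addrC (variation _ _ _ _)).
exact: key.
Qed.

Lemma interval_family1 u v (a b : R) : u <= a -> a <= b -> b <= v ->
  interval_family u v [:: (a, b)].
Proof. by move=> ua ab bv; rewrite /interval_family /= ua ab bv. Qed.

(** An interval shorter than the modulus [d] for the tolerance 1 has variation at most 1; a longer
    one is cut into pieces of length [d / 2], strictly below [d] as the modulus demands. *)
Lemma ac_total_variation_fin u v f : absolutely_continuous_on u v f ->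
  forall x y, u <= x -> x <= y -> y <= v -> total_variation x y f \is a fin_num.
Proof.
move=> /absolutely_continuous_modulus/(_ 1 ltr01)[d d0 acf].
have short x y : u <= x -> x <= y -> y <= v -> y - x < d ->
    total_variation x y f \is a fin_num.
  move=> ux xy yv yxd.
  have := @ac_modulus_total_variation _ _ _ _ _ [::] [:: (x, y)] acf.
  rewrite /= /family_length /family_variation !big_cons !big_nil /= add0e adde0 addr0.
  move=> /(_ (interval_family1 ux xy yv) yxd) H.
  rewrite ge0_fin_numE ?total_variation_ge0//; exact: le_lt_trans H (ltry _).
have steps n : forall x y, u <= x -> x <= y -> y <= v ->
    y - x <= n%:R * (d / 2) -> total_variation x y f \is a fin_num.
  elim: n => [|n ih] x y ux xy yv.
    by rewrite mul0r => ?; apply: short => //; lra.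
  rewrite -natr1 => yxn.
  have [|lt] := ltP (y - x) d; first exact: short.
  rewrite (@total_variationD _ _ _ (x + d / 2)); [|lra..].
  by rewrite fin_numD short ?ih//; lra.
move=> x y ux xy yv; apply: (steps (Num.truncn ((y - x) / (d / 2))).+1) => //.
rewrite -ler_pdivrMr ?divr_gt0//; apply/ltW.
by apply: truncnS_gt.
Qed.

(** Increments of the variation function are total variations, to which [ac_modulus_total_variation]
    applies. The supremum only leaves a weak inequality, hence the modulus of [f] for [e / 2]. *)
Lemma ac_modulus_fine_total_variation u v f :
  absolutely_continuous_on u v f ->
  forall e, 0 < e -> exists2 d, 0 < d &
    ac_modulus u v (fun x => fine (total_variation u x f)) e d.
Proof.
move=> acf e e0; have fin := ac_total_variation_fin acf.
have [d d0 md] := absolutely_continuous_modulus acf (divr_gt0 e0 (ltr0n _ 2)).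
exists d => // s fam len.
have := @ac_modulus_total_variation _ _ _ _ _ [::] s md fam len.
rewrite /family_variation big_nil add0e => H.
suff -> : \sum_(p <- s) `|fine (total_variation u p.2 f) -
    fine (total_variation u p.1 f)| =
    fine (\sum_(p <- s) total_variation p.1 p.2 f)%E.
  have sumfin : (\sum_(p <- s) total_variation p.1 p.2 f)%E \is a fin_num.
    apply/sum_fin_numP => p ps _.
    by case/andP: fam => /allP/(_ _ ps)/and3P[? ? ?] _; rewrite fin.
  by move: H; rewrite -{1}(fineK sumfin) lee_fin => H; lra.
rewrite [in RHS]big_seq -sum_fine; last first.
  move=> p ps; case/andP: fam => /allP/(_ _ ps)/and3P[? ? ?] _.
  by rewrite fin.
rewrite [LHS]big_seq; apply: eq_bigr => p ps.
case/andP: fam => /allP/(_ _ ps)/and3P[u1 p12 p2v] _.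
have u2 := le_trans u1 p12; have p1v := le_trans p12 p2v.
rewrite (@total_variationD _ u p.2 p.1)// fineD ?fin//.
by rewrite addrC addKr ger0_norm// fine_ge0// total_variation_ge0.
Qed.

End total_variation_ac.

(** * Density of an absolutely continuous function *)

Section monotone_density.
Context {R : realType}.
Implicit Types (u v : R) (f g : R -> R) (s : seq (R * R)).
Local Notation mu := (@lebesgue_measure R).

Lemma open_interval_inf_sup (A : set R) : open A -> is_interval A ->
  has_lbound A -> has_ubound A -> A = `]inf A, sup A[%classic.
Proof.
move=> oA iA lA uA; apply/seteqP; split => x /=.
  move=> Ax; have /nbhs_ballP[e /= e0 eA] : nbhs x A by exact: open_nbhs_nbhs.
  have A1 : A (x - e / 2).
    by apply: eA; rewrite /ball /= opprB addrC subrK gtr0_norm; lra.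
  have A2 : A (x + e / 2).
    by apply: eA; rewrite /ball /= opprD addNKr normrN gtr0_norm; lra.
  rewrite in_itv /=; apply/andP; split.
    by apply: (@le_lt_trans _ _ (x - e / 2)); [exact: ge_inf|lra].
  by apply: (@lt_le_trans _ _ (x + e / 2)); [lra|exact: ub_le_sup].
rewrite in_itv /= => /andP[ix xs].
have A0 : A !=set0.
  apply/set0P/eqP => A0; move: (lt_trans ix xs).
  by rewrite A0 inf0 sup0 ltxx.
have [y Ay yx] : exists2 y, A y & y < x.
  by apply: inf_lt => //; split.
have [z Az xz] : exists2 z, A z & x < z.
  by apply: sup_gt => //; split.
by apply: (iA y z Ay Az); rewrite (ltW yx) (ltW xz).
Qed.

(** Projection onto [u, v]. A Stieltjes measure needs a cumulative function on the whole line;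
    composing with [clip] extends a function by its end values. *)
Definition clip u v x : R := Num.max u (Num.min x v).

Lemma clip_homo u v : {homo clip u v : x y / x <= y}.
Proof. by move=> x y xy; rewrite /clip; apply: le_max2 => //; exact: le_min2. Qed.

Lemma clip_ge u v x : u <= clip u v x.
Proof. by rewrite /clip le_max lexx. Qed.

Lemma clip_le u v x : u <= v -> clip u v x <= v.
Proof. by move=> uv; rewrite /clip ge_max uv ge_min lexx orbT. Qed.

Lemma clip_id u v x : u <= x -> x <= v -> clip u v x = x.
Proof. by move=> ux xv; rewrite /clip min_l// max_r. Qed.

Lemma clip_contract u v x y : x <= y -> clip u v y - clip u v x <= y - x.
Proof.
move=> xy; rewrite /clip /Num.max /Num.min.
by case: (ltP y v) => ?; case: (ltP x v) => ?; case: ltP => ?; case: ltP => ?; lra.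
Qed.

Lemma clip_le_left u v x : x <= u -> clip u v x = u.
Proof. by move=> xu; rewrite /clip max_l// ge_min xu. Qed.

Section cumulative_of.
Variables (u v : R) (F : R -> R).
Hypothesis uv : u <= v.
Hypothesis ndF : forall x y, u <= x -> x <= y -> y <= v -> F x <= F y.
Hypothesis acF : forall e, 0 < e -> exists2 d, 0 < d & ac_modulus u v F e d.

Let Fc : R -> R := F \o clip u v.

Let Fc_nd : nondecreasing Fc.
Proof.
move=> x y xy; apply: ndF; [exact: clip_ge|exact: clip_homo|exact: clip_le].
Qed.

Let Fc_modulus e : 0 < e -> exists2 d, 0 < d &
  forall x y, x <= y -> y - x < d -> Fc y - Fc x < e.
Proof.
move=> e0; have [d d0 md] := acF e0; exists d => // x y xy yxd.
have /(_ _ _)/le_lt_trans := md [:: (clip u v x, clip u v y)].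
rewrite /family_length /family_variation !big_cons !big_nil /= !addr0.
move=> H; apply: le_lt_trans (md [:: (clip u v x, clip u v y)] _ _).
- rewrite /family_variation big_cons big_nil /= addr0; exact: ler_norm.
- by apply: interval_family1; [exact: clip_ge|exact: clip_homo|exact: clip_le].
- rewrite /family_length big_cons big_nil /= addr0.
  exact: le_lt_trans (clip_contract _ _ xy) yxd.
Qed.

Let Fc_rc x : Fc y @[y --> x^'+] --> Fc x.
Proof.
apply/cvgrPdist_lt => e e0; have [d d0 md] := Fc_modulus e0.
near=> y; have xy : x <= y by near: y; exact: nbhs_right_ge.
rewrite distrC ger0_norm ?subr_ge0 ?Fc_nd//; apply: md => //.
by rewrite ltrBlDl; near: y; apply: nbhs_right_lt; rewrite ltrDl.
Unshelve. all: by end_near. Qed.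

HB.instance Definition _ := isCumulative.Build R _ R Fc Fc_nd Fc_rc.

Let nu := lebesgue_stieltjes_measure Fc.

Let nu_itv (a b : R) : a <= b -> nu `]a, b] = (Fc b - Fc a)%:E.
Proof.
move=> ab; rewrite /nu /lebesgue_stieltjes_measure /measure_extension.
rewrite measurable_mu_extE /=; last exact: is_ocitv.
by rewrite wlength_itv_bnd// EFinB.
Qed.

(** The components of [U] are countably many disjoint intervals. Finitely many of them, clipped to
    [u, v], form a family of length below [d], so the modulus bounds every partial sum of their
    [nu]-measures. Boundedness of [U] gives the components real end points. *)
Let nu_open e d (U : set R) : ac_modulus u v F e d -> open U ->
  (exists a b, U `<=` `]a, b[) -> (mu U < d%:E)%E -> (nu U <= e%:E)%E.
Proof.
move=> md oU [A [B UAB]] mUd.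
pose I := open_disjoint_itv oU.
have oI k : open (I k) := @open_disjoint_itv_open _ _ oU k.
have mI k : measurable (I k) by exact: open_measurable.
have tI : trivIset setT I := @open_disjoint_itv_trivIset _ _ oU.
have UI : U = \bigcup_k I k := open_disjoint_itv_bigcup oU.
have IAB k : I k `<=` `]A, B[ by move=> x Ix; apply: UAB; rewrite UI; exists k.
have IE k : I k = `]inf (I k), sup (I k)[%classic.
  apply: open_interval_inf_sup => //; first exact: open_disjoint_itv_is_interval.
    by exists A => x /IAB /=; rewrite in_itv /= => /andP[/ltW].
  by exists B => x /IAB /=; rewrite in_itv /= => /andP[_ /ltW].
(* The enumeration may contain empty components, whose [inf] and [sup] are default values. They
   become degenerate intervals at [u], which overlap nothing after clipping. *)
pose a k := if inf (I k) < sup (I k) then inf (I k) else u.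
pose b k := if inf (I k) < sup (I k) then sup (I k) else u.
have ab k : a k <= b k by rewrite /a /b; case: ifPn => // /ltW.
have muI k : mu (I k) = (b k - a k)%:E.
  rewrite IE lebesgue_measure_itv /= lte_fin /a /b; case: ifPn => //.
  by rewrite subrr.
have nuI k : (nu (I k) <= (Fc (b k) - Fc (a k))%:E)%E.
  rewrite /a /b; case: ifPn => [lt|].
    rewrite -(nu_itv (ltW lt)); apply: le_measure; rewrite ?inE//; first exact: mI.
    move=> x; rewrite {1}IE /= !in_itv /= => /andP[-> /ltW]; exact.
  move=> nlt; have -> : I k = set0 by rewrite IE set_itv_ge.
  have nu0 : nu set0 = 0%E by exact: measure0.
  by rewrite subrr -[X in (_ <= X)%E]nu0.
have sepI j k : j != k -> inf (I j) < sup (I j) -> inf (I k) < sup (I k) ->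
    sup (I j) <= inf (I k) \/ sup (I k) <= inf (I j).
  move=> jk neJ neK; apply: contrapT => /not_orP[/negP + /negP].
  rewrite -!ltNge => h1 h2.
  have [x [xj xk]] : exists x, I j x /\ I k x.
    rewrite {1}IE (IE k) /=.
    exists ((Num.max (inf (I j)) (inf (I k)) + Num.min (sup (I j)) (sup (I k))) / 2).
    rewrite !in_itv /= /Num.max /Num.min.
    case: (ltP (inf (I j)) (inf (I k))) => ?;
      case: (ltP (sup (I j)) (sup (I k))) => ?;
      split; apply/andP; split; lra.
  move/trivIsetP : tI => /(_ _ _ Logic.I Logic.I jk)/seteqP[/(_ x) + _].
  by move=> /(_ (conj xj xk)).
pose s n := [seq (clip u v (a k), clip u v (b k)) | k <- iota 0 n].
have fam n : interval_family u v (s n).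
  apply/andP; split.
    apply/allP => _ /mapP[k _ ->] /=.
    by rewrite clip_ge clip_homo//= clip_le.
  rewrite pairwise_map; apply/(pairwiseP 0) => j k jn kn jk /=.
  set j' := nth _ _ _; set k' := nth _ _ _.
  have j'k' : j' != k' by rewrite nth_uniq ?iota_uniq// (ltn_eqF jk).
  rewrite /nonoverlapping /= /a /b.
  case: ifPn => [neJ|_]; last by rewrite clip_le_left// clip_ge.
  case: ifPn => [neK|_]; last by rewrite [clip u v u]clip_le_left// clip_ge orbT.
  by have [h|h] := sepI _ _ j'k' neJ neK; rewrite (@clip_homo u v _ _ h) ?orbT.
have len n : family_length (s n) < d.
  rewrite -lte_fin; apply: le_lt_trans mUd.
  apply: (@le_trans _ _ (\sum_(0 <= k < n) mu (I k))%E).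
    rewrite /family_length big_map /index_iota subn0 /= -sumEFin.
    apply: lee_sum => k _; rewrite muI lee_fin; exact: clip_contract.
  rewrite UI measure_semi_bigcup//; last by rewrite -UI; exact: open_measurable.
  exact: nneseries_lim_ge.
have mUU : measurable U by exact: open_measurable.
have -> : nu U = (\sum_(k <oo) nu (I k))%E.
  rewrite {1}UI; apply: measure_semi_bigcup => //; rewrite -UI; exact: mUU.
apply: lime_le; first exact: is_cvg_nneseries.
near=> n; have /ltW := md _ (fam n) (len n); rewrite -lee_fin; apply: le_trans.
rewrite /family_variation big_map /index_iota subn0 /= -sumEFin.
apply: lee_sum => k _; apply: le_trans (nuI k) _.
by rewrite lee_fin ler_norm.
Unshelve. all: by end_near. Qed.

Let D : set R := `]u, v].
Let mD : measurable D. Proof. exact: measurable_itv. Qed.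
Let nuD : (nu D < +oo)%E. Proof. by rewrite nu_itv// ltry. Qed.

(** By outer regularity a null set lies in open sets of arbitrarily small Lebesgue measure, so
    [nu_open] gives domination by [mu]. Restricting [nu] to ]u, v] makes it a finite measure, and
    its Radon-Nikodym derivative is the density. *)
Lemma ac_monotone_density : exists h : R -> R,
  mu.-integrable [set: R] (EFin \o h) /\
  forall x, u <= x <= v -> F x - F u = \int[mu]_(s in `]u, x]) h s.
Proof.
pose nuD' : {finite_measure set (measurableTypeR R) -> \bar R} :=
  @mfrestr _ (measurableTypeR R) R D nu mD nuD.
have dom : nuD' `<< mu.
  apply/null_content_dominatesP => A mA A0.
  have mAD : measurable (A `&` D) by exact: measurableI.
  have AD0 : mu (A `&` D) = 0%E.
    apply/eqP; rewrite eq_le measure_ge0 andbT -A0.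
    by apply: le_measure; rewrite ?inE//; exact: subIsetl.
  apply/eqP; rewrite eq_le measure_ge0 andbT; apply/lee_addgt0Pr => e e0.
  rewrite add0e; have [d d0 md] := acF e0.
  have ADoo : (mu (A `&` D) < +oo)%E by rewrite AD0 ltry.
  have [U0 [oU0 ADU0]] := lebesgue_regularity_outer mAD ADoo d0.
  move=> U0d; pose U := U0 `&` `]u - 1, v + 1[.
  have oU : open U by apply: openI => //; exact: interval_open.
  have ADU : A `&` D `<=` U.
    move=> x ADx; split; first exact: ADU0.
    by move: ADx => [_]; rewrite /D /= !in_itv /=; lra.
  apply: (@le_trans _ _ (nu U)).
    by apply: le_measure; rewrite ?inE//; exact: open_measurable.
  apply: (nu_open md) => //; first by exists (u - 1), (v + 1) => x [].
  apply: (@le_lt_trans _ _ (mu (U0 `\` (A `&` D) `|` (A `&` D)))).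
    apply: le_measure; rewrite ?inE//.
    - exact: open_measurable.
    - by apply: measurableU => //; apply: measurableD => //; exact: open_measurable.
    - by move=> x [U0x _]; have [|] := pselect ((A `&` D) x); [right|left].
  apply: (@le_lt_trans _ _ (mu (U0 `\` (A `&` D)) + mu (A `&` D))%E).
    apply: measureU2 => //.
    by apply: measurableD => //; exact: open_measurable.
  by rewrite AD0 adde0.
have [h [h0 hfin hint hE]] := @radon_nikodym_sigma_finite _ _ _ mu nuD' dom.
exists (fine \o h); split.
  by apply: eq_integrable hint => // x _ /=; rewrite fineK.
move=> x /andP[ux xv]; rewrite /Rintegral.
under eq_integral do rewrite /= fineK//.
rewrite -hE; last exact: measurable_itv.
rewrite [X in fine X](_ : _ = nu `]u, x]).
  by rewrite nu_itv//= /Fc /= !clip_id.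
rewrite /nuD' /= /mfrestr /mrestr setIidl// /D.
by apply: subset_itvl; rewrite bnd_simp.
Qed.

End cumulative_of.

End monotone_density.

(** * Fundamental theorem of calculus for absolutely continuous functions *)

Section ac_ftc.
Context {R : realType}.
Implicit Types (u v : R) (f g : R -> R).
Local Notation mu := (@lebesgue_measure R).

Lemma aeS (P Q : R -> Prop) : (forall x, P x -> Q x) ->
  {ae mu, forall x, P x} -> {ae mu, forall x, Q x}.
Proof. by move=> PQ; apply: (@filterS _ _ (ae_filter_ringOfSetsType mu)). Qed.

Lemma aeI (P Q : R -> Prop) : {ae mu, forall x, P x} ->
  {ae mu, forall x, Q x} -> {ae mu, forall x, P x /\ Q x}.
Proof.
exact: (@filterI _ _ (ae_filter_ringOfSetsType mu) (fun x => P x) (fun x => Q x)).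
Qed.

(** Jordan decomposition [f = V - (V - f)] with [V] the variation function: both parts are
    nondecreasing and absolutely continuous. *)
Lemma ac_density u v f : u <= v -> absolutely_continuous_on u v f ->
  exists g : R -> R, mu.-integrable [set: R] (EFin \o g) /\
  forall x, u <= x <= v -> f x - f u = \int[mu]_(s in `]u, x]) g s.
Proof.
move=> uv acf; pose V x := fine (total_variation u x f).
have fin := ac_total_variation_fin acf.
have VD x y : u <= x -> x <= y -> y <= v ->
    V y - V x = fine (total_variation x y f).
  move=> ux xy yv; have uy := le_trans ux xy; have xv := le_trans xy yv.
  by rewrite /V (@total_variationD _ u y x)// fineD ?fin// addrC addKr.
have Vnd x y : u <= x -> x <= y -> y <= v -> V x <= V y.
  move=> ux xy yv; rewrite -subr_ge0 VD// fine_ge0//.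
  exact: total_variation_ge0.
have Nnd x y : u <= x -> x <= y -> y <= v -> (V \- f) x <= (V \- f) y.
  move=> ux xy yv; rewrite /= -subr_ge0.
  have -> : V y - f y - (V x - f x) = (V y - V x) - (f y - f x) by ring.
  rewrite VD// subr_ge0 -lee_fin fineK ?fin//.
  apply: le_trans (total_variation_ge f xy); rewrite lee_fin; exact: ler_norm.
have Vac := ac_modulus_fine_total_variation acf.
have Nac e : 0 < e -> exists2 d, 0 < d & ac_modulus u v (V \- f) e d.
  move=> e0; have e2 : 0 < e / 2 by rewrite divr_gt0.
  have [d1 d10 m1] := Vac _ e2.
  have [d2 d20 m2] := absolutely_continuous_modulus acf e2.
  exists (Num.min d1 d2); first by rewrite lt_min d10.
  move=> s fam; rewrite lt_min => /andP[/(m1 _ fam) l1 /(m2 _ fam) l2].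
  rewrite [e]splitr; apply: le_lt_trans (ltrD l1 l2).
  rewrite /family_variation -big_split /=; apply: ler_sum => p _.
  have -> : V p.2 - f p.2 - (V p.1 - f p.1) =
    (V p.2 - V p.1) - (f p.2 - f p.1) by ring.
  exact: ler_normB.
have [g1 [ig1 E1]] := ac_monotone_density uv Vnd Vac.
have [g2 [ig2 E2]] := ac_monotone_density uv Nnd Nac.
exists (g1 \- g2); split; first exact: (integrableB _ ig1 ig2).
move=> x ux; rewrite RintegralB//; last 2 first.
- by apply: integrableS ig1.
- by apply: integrableS ig2.
rewrite -E1// -E2//=; ring.
Qed.

Lemma ac_derivable_ae u v f (g : R -> R) :
  mu.-integrable [set: R] (EFin \o g) ->
  (forall x, u <= x <= v -> f x - f u = \int[mu]_(s in `]u, x]) g s) ->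
  {ae mu, forall x, u < x < v -> derivable f x 1 /\ derive1 f x = g x}.
Proof.
move=> ig E.
have locg : locally_integrable [set: R] g.
  exact: open_integrable_locally openT ig.
have ig' y : mu.-integrable [set` Interval (BRight u) (BRight y)] (EFin \o g).
  by apply: integrableS ig.
have := FTC1 ig' locg; apply: aeS => x /= H /andP[ux xv].
have [] := H ux.
set F := fun _ => _ => dF F'.
have nearE : {near x, F =1 (f \- cst (f u))}.
  near=> y; rewrite /= /F -E//; apply/andP; split; apply/ltW.
    by near: y; exact: lt_nbhsr ux.
  by near: y; exact: lt_nbhsl xv.
have fE : f = (f \- cst (f u)) \+ cst (f u).
  by apply/funext => y /=; rewrite subrK.
have d1 : derivable (f \- cst (f u)) x 1 by apply: near_eq_derivable dF.
split; first by rewrite fE; exact: derivableD.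
rewrite -F' !derive1E fE deriveD//= derive_cst addr0.
by apply: near_eq_derive => //; apply: filterS nearE => y ->.
Unshelve. all: by end_near. Qed.

End ac_ftc.

(** * Operations on controls *)

Section shift.
Context {R : realType}.
Implicit Types (u v h : R) (f g : R -> R).
Local Notation mu := (@lebesgue_measure R).

Lemma measurable_shift h :
  measurable_fun [set: measurableTypeR R]
    (fun s => s + h : measurableTypeR R).
Proof. by apply: measurable_funD. Qed.

Lemma measurable_preimage_shift h (A : set R) : measurable A ->
  measurable ((fun s => s + h) @^-1` A).
Proof.
move=> mA; rewrite -[X in measurable X]setTI.
exact: (@measurable_shift h measurableT A mA).
Qed.

Lemma lebesgue_measure_shift h (A : set R) : measurable A ->
  mu ((fun s => s + h) @^-1` A) = mu A.
Proof.
move=> mA.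
pose nu : {measure set (measurableTypeR R) -> \bar R} :=
  pushforward mu (fun s => s + h : measurableTypeR R).
suff : mu A = nu (@measurable_shift h) A by [].
apply: lebesgue_measure_unique => // _ [[a b] _ <-] /=.
rewrite /pushforward.
rewrite (_ : _ @^-1` _ = `]a - h, b - h]%classic); last first.
  by apply/seteqP; split => s /=; rewrite !in_itv /= ltrBlDr lerBrDr.
rewrite !lebesgue_measure_itv /= !lte_fin ltrD2r; case: ifP => // _.
by rewrite -!EFinB; congr EFin; ring.
Qed.

Lemma ae_shift h (P : R -> Prop) : {ae mu, forall s, P s} ->
  {ae mu, forall s, P (s + h)}.
Proof.
move=> [N [mN N0 PN]]; exists ((fun s => s + h) @^-1` N); split.
- exact: measurable_preimage_shift.
- by rewrite lebesgue_measure_shift.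
- by move=> s /= Ps; apply: PN.
Qed.

Lemma ge0_integral_shiftT h (F : R -> \bar R) :
  measurable_fun [set: R] F -> (forall x, 0 <= F x)%E ->
  (\int[mu]_s F (s + h)%R = \int[mu]_s F s)%E.
Proof.
move=> mF F0.
have H := @ge0_integral_pushforward _ _ _ _ R _ (measurable_shift h) mu setT F measurableT mF.
rewrite preimage_setT in H; rewrite -H; last by move=> y _; exact: F0.
apply: eq_measure_integral => [|? A mA _]; first exact: measurable_shift.
exact: lebesgue_measure_shift.
Qed.

Lemma integral_shiftT h (F : R -> \bar R) :
  measurable_fun [set: R] F ->
  (\int[mu]_s F (s + h)%R = \int[mu]_s F s)%E.
Proof.
move=> mF; rewrite [LHS]integralE [RHS]integralE; congr (_ - _)%E.
  rewrite -(ge0_integral_shiftT h (measurable_funepos mF) (funepos_ge0 F)).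
  by apply: eq_integral => s _; rewrite !funeposE.
rewrite -(ge0_integral_shiftT h (measurable_funeneg mF) (funeneg_ge0 F)).
by apply: eq_integral => s _; rewrite !funenegE.
Qed.

Lemma patch_shift u v h (f : R -> \bar R) :
  (fun s => (f \_ `[u + h, v + h]) (s + h)) = (fun s => f (s + h)) \_ `[u, v].
Proof.
apply/funext => s; rewrite !patchE.
suff -> : (s + h \in `[u + h, v + h]%classic) = (s \in `[u, v]%classic) by [].
by apply/idP/idP; rewrite !inE /= !in_itv /= !lerD2r.
Qed.

Lemma measurable_patch_itv u v (f : R -> R) :
  measurable_fun `[u, v] f <-> measurable_fun [set: R] ((EFin \o f) \_ `[u, v]).
Proof.
split=> [mf|]; first by apply/(measurable_restrictT _ _).1 => //; exact/measurable_EFinP.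
by move/(measurable_restrictT _ (measurable_itv _)).2 => /measurable_EFinP.
Qed.

Lemma measurable_shift_itv u v h f :
  measurable_fun `[u + h, v + h] f -> measurable_fun `[u, v] (fun s => f (s + h)).
Proof.
move=> /measurable_patch_itv mf; apply/measurable_patch_itv.
have := patch_shift u v h (EFin \o f); rewrite /= => <-.
by apply: (measurableT_comp mf); exact: measurable_shift.
Qed.

Lemma integral_shift u v h f : measurable_fun `[u + h, v + h] f ->
  (\int[mu]_(s in `[u, v]) (f (s + h)%R)%:E =
   \int[mu]_(s in `[(u + h)%R, (v + h)%R]) (f s)%:E)%E.
Proof.
move=> /measurable_patch_itv mf; rewrite [LHS]integral_mkcond [RHS]integral_mkcond.
rewrite -[RHS](integral_shiftT h)//; apply: eq_integral => s _.
by have /(congr1 (fun F => F s)) := patch_shift u v h (EFin \o f).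
Qed.

Lemma integrable_shift u v h f :
  mu.-integrable `[u + h, v + h] (fun s => (f s)%:E) ->
  mu.-integrable `[u, v] (fun s => (f (s + h))%:E).
Proof.
move=> /integrableP[/measurable_EFinP mf foo]; apply/integrableP; split.
  by apply/measurable_EFinP; exact: measurable_shift_itv.
apply: le_lt_trans foo; rewrite (@integral_shift u v h (fun s => `|f s|))//.
exact: measurableT_comp.
Qed.

Lemma Rintegral_shift u v h f :
  mu.-integrable `[u + h, v + h] (fun s => (f s)%:E) ->
  \int[mu]_(s in `[u, v]) f (s + h) = \int[mu]_(s in `[u + h, v + h]) f s.
Proof.
by move=> /integrableP[/measurable_EFinP mf _]; rewrite /Rintegral integral_shift.
Qed.

End shift.

(** * Concatenation in time *)

Section gluing.
Context {R : realType}.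
Local Notation mu := (@lebesgue_measure R).

(* The junction gets a value [d] of its own, so that in controls [l] can be set
   to 0 there: the boundary cost, which involves a derivative that need not exist
   at the junction, then vanishes. *)
Definition splice (T : Type) (h : R) (f1 f2 : R -> T) (d : T) (s : R) : T :=
  if s < h then f1 s else if h < s then f2 (s - h) else d.

Lemma integrable_cst_itv (s t k : R) :
  mu.-integrable `[s, t] (fun=> k%:E).
Proof.
apply: measurable_bounded_integrable => //=; last exact: bounded_cst.
by rewrite lebesgue_measure_itv /=; case: ifP => _; rewrite -?EFinB ltry.
Qed.

Lemma integrable_setU (A B : set R) (f : R -> \bar R) :
  measurable A -> measurable B -> mu.-integrable A f -> mu.-integrable B f ->
  mu.-integrable (A `|` B) f.
Proof.
move=> mA mB /integrableP[mfA iA] /integrableP[mfB iB].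
have mf : measurable_fun (A `|` B) f by apply/measurable_funU.
apply/integrableP; split => //.
have mBA : measurable (B `\` A) by exact: measurableD.
have ABE : A `|` B = A `|` (B `\` A).
  apply/seteqP; split => x [Ax|]; [by left| |by left|by move=> [Bx _]; right].
  by move=> Bx; have [Ax|nAx] := pselect (A x); [left|right].
rewrite ABE in mf *.
rewrite ge0_integral_setU//; last 2 first.
- exact: measurableT_comp.
- by apply/disj_setPS => x [Ax []].
rewrite lte_add_pinfty//; apply: le_lt_trans iB.
apply: ge0_subset_integral => //; exact: measurableT_comp.
Qed.

Lemma integrable_splice (h t : R) (f1 f2 : R -> R) (d : R) : 0 <= h -> h <= t ->
  mu.-integrable `[0, h] (fun s => (f1 s)%:E) ->
  mu.-integrable `[0, t - h] (fun s => (f2 s)%:E) ->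
  mu.-integrable `[0, t] (fun s => (splice h f1 f2 d s)%:E).
Proof.
move=> h0 ht i1 i2.
have -> : `[0, t]%classic = `[0, h[ `|` ([set h] `|` `]h, t]) :> set R.
  apply/seteqP; split => s /=; rewrite !in_itv /=.
    move=> /andP[s0 st]; case: (ltgtP s h) => [sh|hs|->].
    - by left; rewrite s0.
    - by right; right; rewrite st.
    - by right; left.
  move=> [/andP[s0 sh]|[->|/andP[hs st]]].
  - by rewrite s0 /= (le_trans (ltW sh)).
  - by rewrite h0.
  - by rewrite st andbT (le_trans h0)// ltW.
apply: integrable_setU => //; first exact: measurableU.
  have : mu.-integrable `[0, h[ (fun s => (f1 s)%:E).
    by apply: integrableS i1 => // s /=; rewrite !in_itv /= => /andP[-> /ltW].
  apply: eq_integrable => // s; rewrite inE /= in_itv /= => /andP[_ sh].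
  by rewrite /splice sh.
apply: integrable_setU => //.
  apply/integrableP; split; first exact: measurable_fun_set1.
  by rewrite integral_set1 ltry.
have : mu.-integrable `]h, t] (fun s => (f2 (s - h))%:E).
  have : mu.-integrable `[h, t] (fun s => (f2 (s - h))%:E).
    by apply: integrable_shift; rewrite subrr.
  by apply: integrableS => // s /=; rewrite !in_itv /= => /andP[/ltW -> ->].
apply: eq_integrable => // s; rewrite inE /= in_itv /= => /andP[hs _].
by rewrite /splice hs ltNge (ltW hs).
Qed.

Lemma Rintegral_itv_cat (f : R -> R) (s h t : R) : s <= h -> h <= t ->
  mu.-integrable `[s, t] (fun s => (f s)%:E) ->
  \int[mu]_(r in `[s, t]) f r =
  \int[mu]_(r in `[s, h]) f r + \int[mu]_(r in `[h, t]) f r.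
Proof.
move=> sh ht ift; apply/eqP; rewrite addrC -subr_eq; apply/eqP.
rewrite (@Rintegral_itvB _ f (BLeft s) (BRight t) h)//.
by rewrite Rintegral_itv_obnd_cbnd//; apply: integrableS ift => //;
  move=> r /=; rewrite !in_itv /= => /andP[/ltW/(le_trans sh) -> ->].
Qed.

Lemma eq_Rintegral_oo (f g : R -> R) (s t : R) :
  mu.-integrable `[s, t] (fun s => (f s)%:E) ->
  mu.-integrable `[s, t] (fun s => (g s)%:E) ->
  (forall r, s < r < t -> f r = g r) ->
  \int[mu]_(r in `[s, t]) f r = \int[mu]_(r in `[s, t]) g r.
Proof.
move=> ifs igs fg.
have sub : (`]s, t[ : set R) `<=` `[s, t] by exact: subset_itv_oo_cc.
have sub1 : (`[s, t[ : set R) `<=` `[s, t].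
  by move=> r /=; rewrite !in_itv /= => /andP[-> /ltW].
rewrite -[LHS]Rintegral_itv_bndo_bndc; last exact: integrableS ifs.
rewrite -[RHS]Rintegral_itv_bndo_bndc; last exact: integrableS igs.
rewrite -[LHS]Rintegral_itv_obnd_cbnd; last exact: integrableS ifs.
rewrite -[RHS]Rintegral_itv_obnd_cbnd; last exact: integrableS igs.
by apply: eq_Rintegral => r; rewrite inE /= in_itv /= => /fg.
Qed.

Lemma integrable_itvS (f : R -> R) (s t s' t' : R) : s <= s' -> t' <= t ->
  mu.-integrable `[s, t] (fun s => (f s)%:E) ->
  mu.-integrable `[s', t'] (fun s => (f s)%:E).
Proof.
move=> ss' tt'; apply: integrableS => // r /=; rewrite !in_itv /= => /andP[h1 h2].
by rewrite (le_trans ss')//= (le_trans h2).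
Qed.

Lemma Rintegral_splice_le (h t : R) (f1 f2 : R -> R) (d s : R) :
  0 <= h -> h <= t ->
  mu.-integrable `[0, h] (fun s => (f1 s)%:E) ->
  mu.-integrable `[0, t - h] (fun s => (f2 s)%:E) ->
  s <= h ->
  \int[mu]_(r in `[0, s]) splice h f1 f2 d r = \int[mu]_(r in `[0, s]) f1 r.
Proof.
move=> h0 ht i1 i2 sh; apply: eq_Rintegral_oo.
- by apply: integrable_itvS (integrable_splice d h0 ht i1 i2) => //; exact: le_trans ht.
- by apply: integrable_itvS i1.
- by move=> r /andP[_ rs]; rewrite /splice (lt_le_trans rs sh).
Qed.

Lemma Rintegral_splice_ge (h t : R) (f1 f2 : R -> R) (d s : R) :
  0 <= h -> h <= t ->
  mu.-integrable `[0, h] (fun s => (f1 s)%:E) ->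
  mu.-integrable `[0, t - h] (fun s => (f2 s)%:E) ->
  h <= s -> s <= t ->
  \int[mu]_(r in `[0, s]) splice h f1 f2 d r =
  \int[mu]_(r in `[0, h]) f1 r + \int[mu]_(r in `[0, s - h]) f2 r.
Proof.
move=> h0 ht i1 i2 hs st; have ig := integrable_splice d h0 ht i1 i2.
rewrite (@Rintegral_itv_cat _ 0 h s)//; last exact: integrable_itvS ig.
rewrite (Rintegral_splice_le d h0 ht i1 i2)//; congr (_ + _).
have i2s : mu.-integrable `[h, s] (fun r => (f2 (r - h))%:E).
  by apply: integrable_shift; rewrite subrr; apply: integrable_itvS i2 => //; lra.
have := @Rintegral_shift _ h s (- h) f2.
rewrite subrr => <-; last by apply: integrable_itvS i2 => //; lra.
apply: eq_Rintegral_oo => //.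
- exact: integrable_itvS ig.
- by move=> r /andP[hr _]; rewrite /splice hr ltNge (ltW hr).
Qed.

Section ac_operations.
Variable V : normedModType R.
Implicit Type f : R -> V.

Lemma ac_onS (u v u' v' : R) f : u <= u' -> v' <= v ->
  absolutely_continuous_on u v f -> absolutely_continuous_on u' v' f.
Proof.
move=> uu' vv' acf e /acf[d d0 H]; exists d => // n s r sr dis len.
apply: H => // i; have [h1 [h2 h3]] := sr i.
by split; [exact: le_trans h1|split; [|exact: le_trans vv']].
Qed.

Lemma ac_on_shift (u v h : R) f : absolutely_continuous_on (u + h) (v + h) f ->
  absolutely_continuous_on u v (fun s => f (s + h)).
Proof.
move=> acf e /acf[d d0 H]; exists d => // n s r sr dis len.
apply: (H n (fun i => s i + h) (fun i => r i + h)).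
- by move=> i; have [h1 [h2 h3]] := sr i; rewrite !lerD2r.
- by move=> i j /dis; rewrite !lerD2r.
- by apply: le_lt_trans len; apply: ler_sum => i _; rewrite opprD addrACA subrr addr0.
Qed.

Lemma ac_on_affine (u v : R) (x w : V) :
  absolutely_continuous_on u v (fun s => x + s *: w).
Proof.
move=> e e0; exists (e / (`|w| + 1)).
  by rewrite divr_gt0// ltr_wpDl.
move=> n s r sr _; rewrite ltr_pdivlMr ?ltr_wpDl// => len.
apply: le_lt_trans len.
rewrite mulr_suml; apply: ler_sum => i _; have [_ [sri _]] := sr i.
rewrite opprD addrACA subrr add0r -scalerBl normrZ ger0_norm ?subr_ge0//.
by rewrite ler_wpM2l ?subr_ge0// lerDl.
Qed.

Lemma ac_on_splice (h t : R) f1 f2 : 0 <= h -> h <= t ->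
  absolutely_continuous_on 0 h f1 -> absolutely_continuous_on 0 (t - h) f2 ->
  f1 h = f2 0 -> absolutely_continuous_on 0 t (splice h f1 f2 (f1 h)).
Proof.
move=> h0 ht ac1 ac2 f12 e e0.
have e2 : 0 < e / 2 by rewrite divr_gt0.
have [d1 d10 H1] := ac1 _ e2; have [d2 d20 H2] := ac2 _ e2.
exists (Num.min d1 d2); first by rewrite lt_min d10.
move=> n s r sr dis; rewrite lt_min => /andP[l1 l2].
(* With the times clipped at [h], the spliced path is a sum of its two pieces. An interval
   containing [h] is thereby cut in two without a case distinction. *)
have spliceE x : 0 <= x -> x <= t ->
    splice h f1 f2 (f1 h) x = f1 (Num.min x h) + f2 (Num.max (x - h) 0) - f1 h.
  move=> x0 xt; rewrite /splice; case: (ltgtP x h) => [xh|hx|->].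
  - by rewrite max_r ?subr_le0 1?ltW// -f12 addrK.
  - by rewrite max_l ?subr_ge0 1?ltW// addrAC subrr add0r.
  - by rewrite subrr maxxx -f12 addrK.
have S1 := H1 n (fun i => Num.min (s i) h) (fun i => Num.min (r i) h).
have S2 := H2 n (fun i => Num.max (s i - h) 0) (fun i => Num.max (r i - h) 0).
rewrite [e]splitr; apply: le_lt_trans (ltrD (S1 _ _ _) (S2 _ _ _)) => //.
- rewrite -big_split /=; apply: ler_sum => i _; have [s0 [sri rt]] := sr i.
  rewrite !spliceE//; last 2 first.
    + exact: le_trans rt.
    + exact: le_trans s0 sri.
  set A := f1 (Num.min (r i) h); set B := f2 _; set C := f1 (Num.min (s i) h).
  set D := f2 _.
  rewrite (_ : _ - _ = (A - C) + (B - D)); first exact: ler_normD.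
  by rewrite opprB addrA subrK opprD addrACA.
- move=> i; have [s0 [sri rt]] := sr i; split; first by rewrite le_min s0 h0.
  by split; [exact: le_min2|rewrite ge_min lexx orbT].
- move=> i j /dis[ij|ij]; [left|right]; exact: le_min2.
- apply: le_lt_trans l1; apply: ler_sum => i _; have [s0 [sri rt]] := sr i.
  by rewrite /Num.min; case: (ltP (r i) h) => ?; case: (ltP (s i) h) => ?; lra.
- move=> i; have [s0 [sri rt]] := sr i; split; first by rewrite le_max lexx orbT.
  split; first by apply: le_max2 => //; rewrite lerD2r.
  by rewrite ge_max subr_ge0 ht lerD2r rt.
- by move=> i j /dis[ij|ij]; [left|right]; apply: le_max2 => //; rewrite lerD2r.
- apply: le_lt_trans l2; apply: ler_sum => i _; have [s0 [sri rt]] := sr i.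
  by rewrite /Num.max; case: (ltP (r i - h) 0) => ?; case: (ltP (s i - h) 0) => ?; lra.
Qed.

End ac_operations.
End gluing.

(** * Derivatives of paths *)

Section derivatives.
Context {R : realType}.

Lemma derive1_near (V : normedModType R) (f g : R -> V) (s : R) :
  {near s, f =1 g} -> derive1 f s = derive1 g s.
Proof. by move=> fg; rewrite !derive1E; exact: near_eq_derive. Qed.

Lemma derive1_eq_oo (V : normedModType R) (f g : R -> V) (u v s : R) :
  (forall r, u < r < v -> f r = g r) -> u < s < v -> derive1 f s = derive1 g s.
Proof.
move=> fg /andP[us sv]; apply: derive1_near; near=> r; apply: fg.
apply/andP; split; first by near: r; exact: lt_nbhsr us.
by near: r; exact: lt_nbhsl sv.
Unshelve. all: by end_near. Qed.

Lemma derive1_shift (V : normedModType R) (f : R -> V) (h s : R) :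
  derive1 (fun r => f (r + h)) s = derive1 f (s + h).
Proof.
rewrite /derive1; set F := fun _ => _; set F' := fun _ => _.
by have -> : F = F' by apply/funext => r; rewrite /F /F' addrA.
Qed.

Lemma derive1_cvg (V : normedModType R) (f : R -> V) (s : R) :
  derivable f s 1 ->
  h^-1 *: (f (h + s) - f s) @[h --> 0^'] --> derive1 f s.
Proof.
rewrite /derivable /derive1.
have -> // : (fun h => h^-1 *: ((f \o shift s) (h *: 1) - f s)) =
  (fun h => h^-1 *: (f (h + s) - f s)).
by apply/funext => h /=; rewrite [h%:A]mulr1.
Qed.

Lemma derive1_pair (f : R -> R * R) (s : R) :
  derivable (fun r => (f r).1) s 1 -> derivable (fun r => (f r).2) s 1 ->
  derive1 f s = (derive1 (fun r => (f r).1) s, derive1 (fun r => (f r).2) s).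
Proof.
move=> /derive1_cvg c1 /derive1_cvg c2.
apply/cvg_lim; first exact: norm_hausdorff.
exact: (cvg_pair c1 c2).
Qed.

Lemma derive1_affine (V : normedModType R) (x w : V) (s : R) :
  derive1 (fun r => x + r *: w) s = w.
Proof.
apply/cvg_lim; first exact: norm_hausdorff.
apply: cvg_near_cst; near=> h.
rewrite opprD addrACA subrr add0r -scalerBl addrK scalerA mulVf ?scale1r//.
by near: h; exact: nbhs_dnbhs_neq.
Unshelve. all: by end_near. Qed.

(* The library's [derive1_at_min] needs a derivative on the whole interval, which
   an absolutely continuous function need not have. *)
Lemma derive1_local_min (f : R -> R) (u v s : R) : u < s < v ->
  (forall r, u < r < v -> f s <= f r) -> derivable f s 1 -> derive1 f s = 0.
Proof.
move=> /andP[us sv] fmin /derive1_cvg dfs; set d := derive1 f s in dfs *.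
apply: contrapT => /eqP d0; have nd0 : 0 < `|d| by rewrite normr_gt0.
have [e /= e0 He] := (cvgrPdist_lt _ _).1 dfs _ nd0.
pose h := Num.min e (Num.min (s - u) (v - s)) / 2.
have h0 : 0 < h by rewrite divr_gt0// !lt_min e0 !subr_gt0 us sv.
have /and3P[he hu hv] : [&& h < e, h < s - u & h < v - s].
  have : h < Num.min e (Num.min (s - u) (v - s)).
    by rewrite /h ltr_pdivrMr// ltr_pMr ?ltr1n// -(pmulr_lgt0 _ (_ : 0 < 2^-1)).
  by rewrite !lt_min.
have := He h; rewrite /= sub0r normrN gtr0_norm// gt_eqF// => /(_ he isT).
have := He (- h); rewrite /= sub0r opprK gtr0_norm// oppr_eq0 gt_eqF// => /(_ he isT).
have fp : 0 <= h^-1 * (f (h + s) - f s).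
  apply: mulr_ge0; first by rewrite invr_ge0 ltW.
  by rewrite subr_ge0; apply: fmin; apply/andP; split; lra.
have fm : 0 <= h^-1 * (f (- h + s) - f s).
  apply: mulr_ge0; first by rewrite invr_ge0 ltW.
  by rewrite subr_ge0; apply: fmin; apply/andP; split; lra.
rewrite invrN scaleNr opprK /GRing.scale /=.
by case: (ltgtP d 0) d0 => // dlt _; rewrite !ltr_norml;
  [rewrite ltr0_norm//|rewrite gtr0_norm//]; lra.
Qed.

End derivatives.

(** * Restriction, concatenation and mixing of controls *)

Section controls.
Context {R : realType}.
Local Notation mu := (@lebesgue_measure R).
Variables (a b c : R).
Hypothesis a_gt0 : 0 < a.
Implicit Types (x : R * R) (t h s : R) (gamma eta : R -> R * R) (l : R -> R).

Definition running_cost gamma eta l s : R :=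
  Lagrangian c (- eta s) + boundary_cost a b gamma eta l s.

Lemma LagrangianN (q : R * R) :
  Lagrangian c (- q) = ((q.1 + c) ^+ 2 + q.2 ^+ 2) / 4 - 1.
Proof. by rewrite /Lagrangian /=; field. Qed.

Lemma boundary_cost_ge0 gamma eta l s : 0 <= boundary_cost a b gamma eta l s.
Proof.
rewrite /boundary_cost; case: ifPn => // l0; apply: mulr_ge0; first exact: ltW.
by rewrite /G; apply: divr_ge0; [exact: sqr_ge0|rewrite mulr_ge0// ltW].
Qed.

Lemma running_cost_ge gamma eta l s : -1 <= running_cost gamma eta l s.
Proof.
rewrite /running_cost LagrangianN.
have := boundary_cost_ge0 gamma eta l s.
have := sqr_ge0 ((eta s).1 + c); have := sqr_ge0 (eta s).2; lra.
Qed.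

Lemma running_cost_eq (u v s : R) gamma gamma' eta eta' l l' : u < s < v ->
  (forall r, u < r < v -> gamma r = gamma' r) -> eta s = eta' s -> l s = l' s ->
  running_cost gamma eta l s = running_cost gamma' eta' l' s.
Proof.
move=> usv gg' ee' ll'; rewrite /running_cost /boundary_cost ee' ll'.
by rewrite (derive1_eq_oo gg' usv).
Qed.

Lemma measurable_running_cost x t gamma eta l : control a b x t gamma eta l ->
  measurable_fun `[0, t] (running_cost gamma eta l).
Proof.
move=> [_ [[/measurable_int/measurable_EFinP m1 /measurable_int/measurable_EFinP m2 _
  /measurable_int/measurable_EFinP m3] _]].
apply: measurable_funD => //.
apply: (eq_measurable_fun
  (fun s => (((eta s).1 + c) ^+ 2 + (eta s).2 ^+ 2) / 4 - 1)).
  by move=> s _; rewrite LagrangianN.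
apply: measurable_funB => //; apply: measurable_funM => //.
apply: measurable_funD; apply: measurable_funX => //.
exact: measurable_funD.
Qed.

Lemma control_prefix x t gamma eta l h : 0 <= h -> h <= t ->
  control a b x t gamma eta l -> control a b x h gamma eta l.
Proof.
move=> h0 ht [[ac hp gx] [[i1 i2 i3 i4] ae]]; split.
  split=> //; first exact: ac_onS ac.
  by move=> s /andP[s0 sh]; apply: hp; rewrite s0 (le_trans sh).
split; first by split; [apply: integrable_itvS i1|apply: integrable_itvS i2|
  apply: integrable_itvS i3|apply: integrable_itvS i4].
apply: aeS ae => s H /andP[s0 sh]; apply: H; by rewrite s0 (le_trans sh).
Qed.

Lemma running_cost_shift gamma eta l h s :
  running_cost (fun r => gamma (r + h)) (fun r => eta (r + h))
    (fun r => l (r + h)) s = running_cost gamma eta l (s + h).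
Proof. by rewrite /running_cost /boundary_cost derive1_shift. Qed.

Lemma control_tail x t gamma eta l h : 0 <= h -> h <= t ->
  control a b x t gamma eta l ->
  control a b (gamma h) (t - h) (fun r => gamma (r + h))
    (fun r => eta (r + h)) (fun r => l (r + h)).
Proof.
move=> h0 ht [[ac hp gx] [[i1 i2 i3 i4] ae]]; split.
  split; last by rewrite add0r.
  - by apply: ac_on_shift; apply: ac_onS ac; lra.
  - by move=> s /andP[s0 sh]; apply: hp; apply/andP; split; lra.
split.
  split.
  - by apply: (@integrable_shift _ _ _ h (fun s => (eta s).1)); apply: integrable_itvS i1; lra.
  - by apply: (@integrable_shift _ _ _ h (fun s => (eta s).2)); apply: integrable_itvS i2; lra.
  - by apply: (@integrable_shift _ _ _ h l); apply: integrable_itvS i3; lra.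
  - rewrite (_ : (fun s => _) =
        (fun s => (boundary_cost a b gamma eta l (s + h))%:E)); last first.
      by apply/funext => s; rewrite /boundary_cost derive1_shift.
    apply: (@integrable_shift _ _ _ h (boundary_cost a b gamma eta l)).
    by apply: integrable_itvS i4; lra.
apply: aeS (ae_shift h ae) => s H /andP[s0 st].
by rewrite derive1_shift; apply: H; apply/andP; split; lra.
Qed.

Lemma splice_lt (T : Type) h (f1 f2 : R -> T) d s : s < h -> splice h f1 f2 d s = f1 s.
Proof. by rewrite /splice => ->. Qed.

Lemma splice_gt (T : Type) h (f1 f2 : R -> T) d s : h < s ->
  splice h f1 f2 d s = f2 (s - h).
Proof. by move=> hs; rewrite /splice hs ltNge (ltW hs). Qed.

Lemma splice_mid (T : Type) h (f1 f2 : R -> T) d : splice h f1 f2 d h = d.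
Proof. by rewrite /splice ltxx. Qed.

Lemma derive1_splice h gamma1 gamma2 d s : s != h ->
  derive1 (splice h gamma1 gamma2 d) s = splice h (derive1 gamma1) (derive1 gamma2) 0 s.
Proof.
rewrite neq_lt => /orP[sh|hs].
  rewrite [RHS](splice_lt _ _ _ sh).
  apply: (@derive1_eq_oo _ _ (splice h gamma1 gamma2 d) gamma1 (s - 1) h).
    by move=> r /andP[_ rh]; rewrite splice_lt.
  by apply/andP; split; lra.
rewrite [RHS](splice_gt _ _ _ hs) -derive1_shift.
apply: (@derive1_eq_oo _ _ (splice h gamma1 gamma2 d)
  (fun r => gamma2 (r - h)) h (s + 1)).
  by move=> r /andP[hr _]; rewrite splice_gt.
by apply/andP; split; lra.
Qed.

Lemma boundary_cost_splice h gamma1 gamma2 d eta1 eta2 l1 l2 e s :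
  boundary_cost a b (splice h gamma1 gamma2 d) (splice h eta1 eta2 e)
    (splice h l1 l2 0) s =
  splice h (boundary_cost a b gamma1 eta1 l1) (boundary_cost a b gamma2 eta2 l2) 0 s.
Proof.
have [->|sh] := eqVneq s h; first by rewrite /boundary_cost !splice_mid ltxx.
rewrite /boundary_cost derive1_splice//.
move: sh; rewrite neq_lt => /orP[sh|hs].
  by rewrite !(splice_lt _ _ _ sh).
by rewrite !(splice_gt _ _ _ hs).
Qed.

Lemma running_cost_splice h gamma1 gamma2 d eta1 eta2 l1 l2 e s :
  running_cost (splice h gamma1 gamma2 d) (splice h eta1 eta2 e)
    (splice h l1 l2 0) s =
  splice h (running_cost gamma1 eta1 l1) (running_cost gamma2 eta2 l2)
    (Lagrangian c (- e)) s.
Proof.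
rewrite /running_cost boundary_cost_splice /splice.
by case: ifP => // _; case: ifP => // _; rewrite addr0.
Qed.

Lemma ae_neq (h : R) : {ae mu, forall s : R, s != h}.
Proof.
exists [set h]; split => //; first exact: lebesgue_measure_set1.
by move=> s /= /negP/negbNE/eqP.
Qed.

Lemma control_splice x t h gamma1 eta1 l1 gamma2 eta2 l2 (e : R * R) : 0 <= h -> h <= t ->
  control a b x h gamma1 eta1 l1 ->
  control a b (gamma1 h) (t - h) gamma2 eta2 l2 ->
  control a b x t (splice h gamma1 gamma2 (gamma1 h)) (splice h eta1 eta2 e)
    (splice h l1 l2 0).
Proof.
move=> h0 ht [[ac1 hp1 g1x] [[i1 i2 i3 i4] ae1]].
move=> [[ac2 hp2 g2x] [[j1 j2 j3 j4] ae2]]; split.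
  split.
  - by apply: ac_on_splice.
  - move=> s /andP[s0 st]; case: (ltgtP s h) => [sh|hs|->].
    + by rewrite splice_lt//; apply: hp1; rewrite s0 ltW.
    + by rewrite splice_gt//; apply: hp2; apply/andP; split; lra.
    + by rewrite splice_mid; apply: hp1; rewrite h0 lexx.
  - rewrite /splice; case: ifPn => //; rewrite -leNgt => hle.
    have -> : h = 0 by apply/eqP; rewrite eq_le hle h0.
    by rewrite ltxx.
have comp (p : R * R -> R) : (fun s => (p (splice h eta1 eta2 e s))%:E) =
    (fun s => (splice h (p \o eta1) (p \o eta2) (p e) s)%:E).
  by apply/funext => s; rewrite /splice; case: ifP => // _; case: ifP.
split.
  split.
  - by rewrite (comp fst); exact: integrable_splice.
  - by rewrite (comp snd); exact: integrable_splice.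
  - exact: integrable_splice.
  - rewrite (_ : (fun s => _) = (fun s => (splice h (boundary_cost a b gamma1 eta1 l1)
      (boundary_cost a b gamma2 eta2 l2) 0 s)%:E)); first exact: integrable_splice.
    by apply/funext => s; rewrite boundary_cost_splice.
apply: aeS (aeI (aeI ae1 (ae_shift (- h) ae2)) (ae_neq h)).
move=> s [[H1 H2] sh] /andP[s0 st]; rewrite derive1_splice//.
move: sh; rewrite neq_lt => /orP[sh|hs].
  by rewrite !(splice_lt _ _ _ sh); apply: H1; rewrite s0 ltW.
by rewrite !(splice_gt _ _ _ hs); apply: H2; apply/andP; split; lra.
Qed.

Lemma integrable_mix (t : R) (D : set R) (f f' : R -> R) :
  measurable D -> D `<=` `[0, t] ->
  mu.-integrable D (fun s => (f' s)%:E) ->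
  mu.-integrable `[0, t] (fun s => (f s)%:E) ->
  mu.-integrable `[0, t] (fun s => (if s \in D then f' s else f s)%:E).
Proof.
move=> mD Dt iD it.
have -> : `[0, t]%classic = D `|` (`[0, t] `\` D).
  apply/seteqP; split => [s st|s [/Dt//|[]//]].
  by have [Ds|nDs] := pselect (D s); [left|right].
apply: integrable_setU => //; first exact: measurableD.
  by apply: eq_integrable iD => // s sD; rewrite sD.
have : mu.-integrable (`[0, t] `\` D) (fun s => (f s)%:E).
  by apply: integrableS it => //; exact: measurableD.
apply: eq_integrable; first exact: measurableD.
by move=> s; rewrite inE => -[_ /= nD]; rewrite memNset.
Qed.

Lemma running_cost_mix (s0 : R) (D : set R) gamma eta l gamma' eta' l' s :
  D `<=` `]0, s0[ -> (forall r, 0 <= r <= s0 -> gamma r = gamma' r) ->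
  running_cost gamma (fun r => if r \in D then eta' r else eta r)
    (fun r => if r \in D then l' r else l r) s =
  if s \in D then running_cost gamma' eta' l' s else running_cost gamma eta l s.
Proof.
move=> Ds0 gg'; case: ifPn => sD; last first.
  by rewrite /running_cost /boundary_cost (negPf sD).
have /Ds0 := set_mem sD; rewrite /= in_itv /= => sI.
apply: (running_cost_eq sI); rewrite ?sD// => r /andP[r0 rs].
by apply: gg'; rewrite !ltW.
Qed.

(** The conditions on [(eta, l)] at time [s] involve the path only through [gamma s] and its
    derivative. The two paths agree on [0, s0] only, so [D] has to lie in the open interval for the
    derivatives to agree as well. *)
Lemma control_mix x t s0 (D : set R) gamma eta l gamma' eta' l' :
  0 <= s0 -> s0 <= t -> measurable D -> D `<=` `]0, s0[ ->
  control a b x t gamma eta l -> control a b x s0 gamma' eta' l' ->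
  (forall r, 0 <= r <= s0 -> gamma r = gamma' r) ->
  control a b x t gamma (fun r => if r \in D then eta' r else eta r)
    (fun r => if r \in D then l' r else l r).
Proof.
move=> s00 s0t mD Ds0 [[ac hp gx] [[i1 i2 i3 i4] ae]].
move=> [[ac' hp' gx'] [[j1 j2 j3 j4] ae']] gg'; split => //.
have Dt : D `<=` `[0, t].
  by move=> r /Ds0 /=; rewrite !in_itv /= => /andP[/ltW -> /ltW/le_trans->].
have Ds : D `<=` `[0, s0].
  by move=> r /Ds0 /=; rewrite !in_itv /= => /andP[/ltW -> /ltW].
have dgg' s : s \in D -> derive1 gamma s = derive1 gamma' s.
  move=> /set_mem/Ds0 /=; rewrite in_itv /= => sI.
  apply: (derive1_eq_oo _ sI) => r /andP[r0 rs].
  by apply: gg'; rewrite !ltW.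
split; first split.
- rewrite (_ : (fun s => _) =
      (fun s => (if s \in D then (eta' s).1 else (eta s).1)%:E)); last first.
    by apply/funext => s; case: ifP.
  by apply: integrable_mix => //; apply: integrableS j1.
- rewrite (_ : (fun s => _) =
      (fun s => (if s \in D then (eta' s).2 else (eta s).2)%:E)); last first.
    by apply/funext => s; case: ifP.
  by apply: integrable_mix => //; apply: integrableS j2.
- by apply: integrable_mix => //; apply: integrableS j3.
- rewrite (_ : (fun s => _) = (fun s => (if s \in D then
      boundary_cost a b gamma' eta' l' s else boundary_cost a b gamma eta l s)%:E)).
    by apply: integrable_mix => //; apply: integrableS j4.
  apply/funext => s; rewrite /boundary_cost.
  by case: (boolP (s \in D)) => [sD|_]; rewrite ?(dgg' _ sD).
apply: aeS (aeI ae ae') => s [H H'] st.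
case: ifPn => sD; last exact: H.
have /Ds := set_mem sD; rewrite /= in_itv /= => sI.
have := H' sI; rewrite -dgg'// -gg'//.
Qed.

Lemma control_affine x h (v eta : R * R) (l : R) : 0 <= l ->
  (l = 0 -> v = eta) -> (l <> 0 -> [/\ x.2 = 0, v.2 = 0 & eta.2 = - l]) ->
  half_plane R x -> half_plane R (x + h *: v) -> 0 <= h ->
  control a b x h (fun s => x + s *: v) (cst eta) (cst l).
Proof.
move=> l0 lv lb hx hxh h0; split.
  split; [exact: ac_on_affine| |by rewrite scale0r addr0].
  move=> s /andP[s0 sh]; move: hx hxh; rewrite /half_plane /= => hx hxh.
  have [v0|v0] := leP 0 v.2.
    by rewrite addr_ge0// mulr_ge0.
  apply: le_trans hxh _; rewrite lerD2l /=.
  by rewrite ler_wnM2r// ltW.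
split.
  split; [exact: integrable_cst_itv..|].
  rewrite (_ : (fun s => _) = (fun s =>
    (if 0 < l then l * G a b ((eta.1 - v.1) / l) else 0)%:E)).
    exact: integrable_cst_itv.
  by apply/funext => s; rewrite /boundary_cost derive1_affine.
apply: aeW => s _; rewrite derive1_affine; split => //.
  move=> g2; apply: contrapT => /lb[x20 v20 _]; apply: g2.
  by rewrite /= x20 v20 add0r; exact: mulr0.
by move=> /lb[_ -> ->]; rewrite add0r.
Qed.

End controls.

(** * Fenchel duality along controls *)

Section duality.
Context {R : realType}.
Local Notation mu := (@lebesgue_measure R).
Variables (a b c : R).
Hypothesis a_gt0 : 0 < a.
Implicit Types (x : R * R) (t h s : R) (gamma eta : R -> R * R) (l : R -> R).

Definition Hamiltonian (P : R * R) : R := P.1 ^+ 2 + P.2 ^+ 2 + c * P.1 + 1.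
(** The symbol of the boundary condition: [boundary_op] is [road] evaluated at the gradient. *)
Definition road (P : R * R) : R := a * P.1 ^+ 2 + b * P.1 - P.2.

Lemma ac_fst (u v : R) gamma : absolutely_continuous_on u v gamma ->
  absolutely_continuous_on u v (fun s => (gamma s).1).
Proof.
move=> ac e /ac[d d0 H]; exists d => // n s r sr dis len.
apply: le_lt_trans (H n s r sr dis len); apply: ler_sum => i _.
by rewrite [leRHS]prod_normE le_max lexx.
Qed.

Lemma ac_snd (u v : R) gamma : absolutely_continuous_on u v gamma ->
  absolutely_continuous_on u v (fun s => (gamma s).2).
Proof.
move=> ac e /ac[d d0 H]; exists d => // n s r sr dis len.
apply: le_lt_trans (H n s r sr dis len); apply: ler_sum => i _.
by rewrite [leRHS]prod_normE le_max lexx orbT.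
Qed.

Lemma le_Rintegral_ae (s0 s1 C : R) (f : R -> R) : s0 <= s1 ->
  mu.-integrable `[s0, s1] (fun s => (f s)%:E) ->
  {ae mu, forall s, s0 < s < s1 -> C <= f s} ->
  C * (s1 - s0) <= \int[mu]_(s in `[s0, s1]) f s.
Proof.
move=> s01 fi aeC.
have mf : measurable_fun `[s0, s1] f by move/measurable_int/measurable_EFinP : fi.
(* The bound holds only almost everywhere; [max (f, C)] has the same integral and satisfies it
   everywhere. *)
have mmax : measurable_fun `[s0, s1] (fun s => Num.max (f s) C).
  exact: measurable_maxr.
have maxi : mu.-integrable `[s0, s1] (fun s => (Num.max (f s) C)%:E).
  have : mu.-integrable `[s0, s1] (fun s => (`|f s| + `|C|)%:E).
    by apply: (integrableD _ (integrable_norm fi) (integrable_cst_itv _ _ `|C|)).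
  apply: le_integrable => //; first exact/measurable_EFinP.
  move=> s _ /=; rewrite lee_fin.
  rewrite [leRHS]ger0_norm ?addr_ge0//.
  by rewrite /Num.max; case: ifP => _; rewrite ?lerDl ?lerDr.
have -> : \int[mu]_(s in `[s0, s1]) f s =
    \int[mu]_(s in `[s0, s1]) Num.max (f s) C.
  rewrite /Rintegral; congr fine; apply: ae_eq_integral => //.
  - exact/measurable_EFinP.
  - exact/measurable_EFinP.
  apply: aeS (aeI aeC (aeI (ae_neq s0) (ae_neq s1))).
  move=> s [H [n0 n1]]; rewrite /= in_itv /= => /andP[h0 h1].
  by rewrite max_l// H// !lt_neqAle h0 h1 eq_sym n0 n1.
have -> : C * (s1 - s0) = \int[mu]_(s in `[s0, s1]) C.
  rewrite Rintegral_cst//= lebesgue_measure_itv /= lte_fin.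
  case: ltP => //= s10; have -> : s0 = s1 by apply/eqP; rewrite eq_le s01.
  by rewrite subrr.
apply: le_Rintegral => //; first exact: integrable_cst_itv.
by move=> s _; rewrite le_max lexx orbT.
Qed.

(* [G] is the Legendre transform of [r |-> a r^2 + b r]. *)
Lemma fenchel_boundary (q p r l : R) : 0 < l ->
  - (l * (a * r ^+ 2 + b * r)) <= l * G a b ((q - p) / l) - r * (q - p).
Proof.
move=> l0; rewrite -subr_ge0 /G.
have -> : l * (((q - p) / l - b) ^+ 2 / (4 * a)) - r * (q - p) -
    - (l * (a * r ^+ 2 + b * r)) =
    l * ((q - p) / l - b - 2 * a * r) ^+ 2 / (4 * a).
  by field; rewrite ?(gt_eqF l0) ?(gt_eqF a_gt0).
apply: divr_ge0; apply: mulr_ge0 => //; [exact: ltW|exact: sqr_ge0|exact: ltW].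
Qed.

Lemma fenchel_interior (eta P : R * R) : - Hamiltonian P <=
  Lagrangian c (- eta) + P.1 * eta.1 + P.2 * eta.2.
Proof.
rewrite -subr_ge0 LagrangianN /Hamiltonian.
have := sqr_ge0 ((eta.1 + c) / 2 + P.1); have := sqr_ge0 (eta.2 / 2 + P.2).
lra.
Qed.

(** Sum of the two Fenchel inequalities. Substituting [eta_2 = p_2 - l] collects the boundary terms
    into [l * road P], which is harmless when [road P <= 0]. *)
Lemma running_cost_fenchel gamma eta l s (P p : R * R) :
  derive1 gamma s = p -> 0 <= l s -> (l s = 0 -> p = eta s) ->
  (l s <> 0 -> (eta s).2 = p.2 - l s) ->
  - Hamiltonian P - l s * road P <=
    running_cost a b c gamma eta l s + P.1 * p.1 + P.2 * p.2.
Proof.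
move=> dg l0 lE lN; rewrite /running_cost /boundary_cost dg.
have := fenchel_interior (eta s) P.
move: l0; rewrite le_eqVlt => /orP[/eqP l0|l0].
  by rewrite -l0 ltxx mul0r subr0 addr0 (lE (esym l0)).
rewrite l0; have l1 : l s <> 0 by move=> l1; rewrite l1 ltxx in l0.
have := fenchel_boundary (eta s).1 p.1 P.1 l0; rewrite (lN l1) /road; lra.
Qed.

(** With [p_2 = 0] where [l <> 0], the Lagrangian contains [l^2 / 4], and [l^2 / 4 - l K >= - K^2]
    for [K = a P_1^2 + b P_1]. Hence no sign condition on [road P]. *)
Lemma running_cost_coercive gamma eta l s (P p : R * R) :
  derive1 gamma s = p -> 0 <= l s -> (l s = 0 -> p = eta s) ->
  (l s <> 0 -> (eta s).2 = p.2 - l s) -> (l s <> 0 -> p.2 = 0) ->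
  - (Hamiltonian P + (a * P.1 ^+ 2 + b * P.1) ^+ 2) <=
    running_cost a b c gamma eta l s + P.1 * p.1 + P.2 * p.2.
Proof.
move=> dg l0 lE lN lP; have [ls0|ls0] := pselect (l s = 0).
  have := @running_cost_fenchel gamma eta l s P p dg l0 lE lN.
  rewrite ls0 mul0r subr0; apply: le_trans; rewrite lerN2 lerDl; exact: sqr_ge0.
have ls : 0 < l s by rewrite lt_neqAle l0 andbT eq_sym; exact/eqP.
rewrite /running_cost /boundary_cost dg ls LagrangianN.
have := fenchel_boundary (eta s).1 p.1 P.1 ls.
rewrite (lN ls0) (lP ls0) sub0r sqrrN /Hamiltonian.
set K := a * P.1 ^+ 2 + b * P.1; set B := _ * G _ _ _.
have := sqr_ge0 (((eta s).1 + c) / 2 + P.1); have := sqr_ge0 (l s / 2 - K).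
have := sqr_ge0 P.2; lra.
Qed.

(** Since [derive1 gamma] is meaningful only almost everywhere, increments are expressed through
    integrable densities that coincide with it there. *)
Lemma control_velocity x t gamma eta l : 0 <= t -> control a b x t gamma eta l ->
  exists g1 g2 : R -> R,
  [/\ mu.-integrable [set: R] (EFin \o g1), mu.-integrable [set: R] (EFin \o g2),
      forall s0 s1, 0 <= s0 -> s0 <= s1 -> s1 <= t ->
        (gamma s1).1 - (gamma s0).1 = \int[mu]_(s in `[s0, s1]) g1 s /\
        (gamma s1).2 - (gamma s0).2 = \int[mu]_(s in `[s0, s1]) g2 s &
      {ae mu, forall s, 0 < s < t ->
         [/\ derive1 gamma s = (g1 s, g2 s), (gamma s).2 = 0 -> g2 s = 0,
             0 <= l s, (gamma s).2 <> 0 -> l s = 0 &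
             (l s = 0 -> (g1 s, g2 s) = eta s) /\
             (l s <> 0 -> (eta s).2 = g2 s - l s)]}].
Proof.
move=> t0 [[ac hp gx] [_ aec]].
have [g1 [i1 E1]] := ac_density t0 (ac_fst ac).
have [g2 [i2 E2]] := ac_density t0 (ac_snd ac).
exists g1, g2; split => //.
  have incr (f g : R -> R) : mu.-integrable [set: R] (EFin \o g) ->
      (forall r, 0 <= r <= t -> f r - f 0 = \int[mu]_(s in `]0, r]) g s) ->
      forall s0 s1, 0 <= s0 -> s0 <= s1 -> s1 <= t ->
      f s1 - f s0 = \int[mu]_(s in `[s0, s1]) g s.
    move=> ig E s0 s1 h0 h1 h2.
    have igS (i : interval R) : mu.-integrable [set` i] (EFin \o g).
      by apply: integrableS ig.
    rewrite -Rintegral_itv_obnd_cbnd//.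
    rewrite -(@Rintegral_itvB _ g (BRight 0) (BRight s1) s0)// -!E.
    - by rewrite opprB addrA subrK.
    - by rewrite h0 (le_trans h1).
    - by rewrite h2 (le_trans h0).
  by move=> s0 s1 h0 h1 h2; rewrite (incr _ _ i1 E1)// (incr _ _ i2 E2).
have D1 := ac_derivable_ae i1 E1; have D2 := ac_derivable_ae i2 E2.
apply: aeS (aeI (aeI D1 D2) aec) => s [[d1 d2] H] /[dup] st /andP[s0 s1].
have [df1 e1] := d1 st; have [df2 e2] := d2 st.
have dg : derive1 gamma s = (g1 s, g2 s) by rewrite derive1_pair// e1 e2.
have [|l0 gl ll lb] := H; first by rewrite !ltW.
split => //.
(* where gamma_2 vanishes, it is minimal *)
- move=> g20; rewrite -e2; apply: derive1_local_min st _ df2.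
  by move=> r /andP[r0 rt]; rewrite g20; apply: hp; rewrite !ltW.
- by rewrite -dg; split => // lne; rewrite lb// dg.
Qed.

(** Integration of a pointwise bound. The premise offers every fact known almost everywhere along a
    control, so that both [running_cost_fenchel] and [running_cost_coercive] can supply it. *)
Lemma control_duality x t gamma eta l s0 s1 (P : R * R) (C : R) :
  0 <= s0 -> s0 <= s1 -> s1 <= t -> control a b x t gamma eta l ->
  mu.-integrable `[0, t] (fun s => (running_cost a b c gamma eta l s)%:E) ->
  (forall s (p : R * R), s0 < s < s1 ->
     derive1 gamma s = p -> 0 <= l s -> (l s = 0 -> p = eta s) ->
     (l s <> 0 -> (eta s).2 = p.2 - l s) -> (l s <> 0 -> p.2 = 0) ->
     (l s <> 0 -> (gamma s).2 = 0) ->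
     C <= running_cost a b c gamma eta l s + P.1 * p.1 + P.2 * p.2) ->
  C * (s1 - s0) <= \int[mu]_(s in `[s0, s1]) running_cost a b c gamma eta l s
    + P.1 * ((gamma s1).1 - (gamma s0).1) + P.2 * ((gamma s1).2 - (gamma s0).2).
Proof.
move=> h0 h01 h1 con ik H.
have t0 : 0 <= t by rewrite (le_trans h0)// (le_trans h01).
have [g1 [g2 [i1 i2 E aeg]]] := control_velocity t0 con.
have [-> ->] := E _ _ h0 h01 h1.
have ik' := integrable_itvS h0 h1 ik.
have i1' : mu.-integrable `[s0, s1] (fun s => (P.1 * g1 s)%:E).
  rewrite (_ : (fun s => _) = (fun s => P.1%:E * (g1 s)%:E)%E) //.
  by apply: integrableZl => //; apply: integrableS i1.
have i2' : mu.-integrable `[s0, s1] (fun s => (P.2 * g2 s)%:E).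
  rewrite (_ : (fun s => _) = (fun s => P.2%:E * (g2 s)%:E)%E) //.
  by apply: integrableZl => //; apply: integrableS i2.
have i3 : mu.-integrable `[s0, s1]
    (fun s => (running_cost a b c gamma eta l s + P.1 * g1 s)%:E).
  exact: (integrableD _ ik' i1').
have -> : P.1 * \int[mu]_(s in `[s0, s1]) g1 s =
    \int[mu]_(s in `[s0, s1]) (P.1 * g1 s).
  by rewrite RintegralZl//; apply: integrableS i1.
have -> : P.2 * \int[mu]_(s in `[s0, s1]) g2 s =
    \int[mu]_(s in `[s0, s1]) (P.2 * g2 s).
  by rewrite RintegralZl//; apply: integrableS i2.
rewrite -RintegralD// -RintegralD//.
apply: le_Rintegral_ae => //; first exact: (integrableD _ i3 i2').
apply: aeS aeg => s Hs /[dup] ss /andP[ss0 ss1].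
have [|dg g20 l0 gl [ll lb]] := Hs.
  by rewrite (le_lt_trans h0)//= (lt_le_trans ss1).
have lg : l s <> 0 -> (gamma s).2 = 0 by move=> ls; apply: contrapT => /gl.
by apply: (H s (g1 s, g2 s)) => // ls; apply: g20; exact: lg.
Qed.

End duality.

(** * The value as a problem without stopping *)

Section value.
Context {R : realType}.
Local Notation mu := (@lebesgue_measure R).
Variables (a b c : R) (g0 : R * R -> R).
Hypotheses (a_gt0 : 0 < a) (b_gt0 : 0 < b) (c_gt0 : 0 < c).
Hypothesis g0_gt0 : forall x, half_plane R x -> 0 < g0 x.
Implicit Types (x : R * R) (t h s M : R) (gamma eta : R -> R * R) (l : R -> R).
Local Notation cost := (running_cost a b c).

(** Epigraph form of the running maximum: a level [M] bounds the partial costs and the final payoff,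
    so no supremum over time has to be formed. The clause at [s = 0] forces [0 <= M], which is where
    the obstacle [v >= 0] enters. *)
Definition admissible_level x t M : Prop :=
  exists gamma eta l,
  [/\ control a b x t gamma eta l,
      mu.-integrable `[0, t] (fun s => (cost gamma eta l s)%:E),
      forall s, 0 <= s <= t -> \int[mu]_(r in `[0, s]) cost gamma eta l r <= M &
      \int[mu]_(r in `[0, t]) cost gamma eta l r + g0 (gamma t) <= M].

Definition path_value x t : R := inf [set M | admissible_level x t M].

Lemma Rintegral_itv0 (f : R -> R) : \int[mu]_(r in `[0, 0]) f r = 0.
Proof. by rewrite set_itv1 Rintegral_set1. Qed.

Lemma level_ge0 x t M : 0 <= t -> admissible_level x t M -> 0 <= M.
Proof.
move=> t0 [gamma [eta [l [_ _ H _]]]].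
by have := H 0; rewrite Rintegral_itv0; apply; rewrite lexx t0.
Qed.

Lemma level_le x t M M' : M <= M' -> admissible_level x t M ->
  admissible_level x t M'.
Proof.
move=> MM' [gamma [eta [l [con ik H1 H2]]]]; exists gamma, eta, l; split => //.
  by move=> s /H1/le_trans; exact.
exact: le_trans MM'.
Qed.

Definition affine_cost (v eta : R * R) (l : R) : R :=
  Lagrangian c (- eta) +
  (if 0 < l then l * G a b ((eta.1 - v.1) / l) else 0).

Definition affine_control x h (v eta : R * R) (l : R) : Prop :=
  [/\ 0 <= l, l = 0 -> v = eta,
      l <> 0 -> [/\ x.2 = 0, v.2 = 0 & eta.2 = - l] &
      half_plane R (x + h *: v)].

Lemma running_cost_affine x (v eta : R * R) (l : R) s :
  cost (fun s => x + s *: v) (cst eta) (cst l) s = affine_cost v eta l.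
Proof. by rewrite /running_cost /boundary_cost derive1_affine. Qed.

Lemma level0 x M : half_plane R x -> g0 x <= M -> admissible_level x 0 M.
Proof.
move=> hx gM; exists (fun s => x + s *: 0), (cst 0), (cst 0); split.
- by apply: control_affine => //; rewrite scaler0 addr0.
- rewrite (_ : (fun s => _) = (fun=> (affine_cost 0 0 0)%:E)).
    exact: integrable_cst_itv.
  by apply/funext => s; rewrite running_cost_affine.
- move=> s; rewrite -eq_le => /eqP <-; rewrite Rintegral_itv0.
  exact: le_trans (ltW (g0_gt0 hx)) gM.
- by rewrite Rintegral_itv0 add0r scaler0 addr0.
Qed.

Lemma Rintegral_cst_itv (s k : R) : 0 <= s -> \int[mu]_(r in `[0, s]) k = k * s.
Proof.
move=> s0; rewrite Rintegral_cst//= lebesgue_measure_itv /= lte_fin.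
case: ltP => [_|s1] /=; first by rewrite subr0.
by rewrite (_ : s = 0) ?mulr0//; apply/eqP; rewrite eq_le s1.
Qed.

(** On the affine piece the partial cost is linear in time, hence at most the larger of 0 and its
    value at [h]; the latter is below [M] because [M'] is nonnegative. *)
Lemma level_step x t h M M' (v eta : R * R) (l : R) : half_plane R x ->
  0 <= h -> h <= t -> affine_control x h v eta l ->
  admissible_level (x + h *: v) (t - h) M' ->
  0 <= M -> h * affine_cost v eta l + M' <= M -> admissible_level x t M.
Proof.
move=> hx h0 ht [l0 lv lb hxh] lev M0 kM.
have th0 : 0 <= t - h by rewrite subr_ge0.
have M'0 := level_ge0 th0 lev.
have [gamma [eta' [l' [con ik H1 H2]]]] := lev.
pose gamma1 := fun s => x + s *: v.
pose k0 := affine_cost v eta l.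
have con1 : control a b x h gamma1 (cst eta) (cst l) by exact: control_affine.
have ik1 : mu.-integrable `[0, h] (fun=> k0%:E) by exact: integrable_cst_itv.
exists (splice h gamma1 gamma (gamma1 h)), (splice h (cst eta) eta' 0),
  (splice h (cst l) l' 0).
have costE : cost (splice h gamma1 gamma (gamma1 h)) (splice h (cst eta) eta' 0)
    (splice h (cst l) l' 0) =
    splice h (cst k0) (cost gamma eta' l') (Lagrangian c (- 0)).
  apply/funext => s; rewrite running_cost_splice.
  by congr (splice _ _ _ _); apply/funext => r; rewrite running_cost_affine.
have intge s : h <= s -> s <= t ->
    \int[mu]_(r in `[0, s]) splice h (cst k0) (cost gamma eta' l') (Lagrangian c (- 0)) r =
    h * k0 + \int[mu]_(r in `[0, s - h]) cost gamma eta' l' r.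
  move=> hs st; rewrite (Rintegral_splice_ge _ h0 ht ik1 ik)//.
  by rewrite Rintegral_cst_itv// mulrC.
split.
- exact: control_splice.
- by rewrite costE; exact: integrable_splice.
- rewrite costE => s /andP[s0 st]; have [sh|hs] := leP s h.
    rewrite (Rintegral_splice_le _ h0 ht ik1 ik)// Rintegral_cst_itv//.
    have [k00|k00] := leP 0 k0; last first.
      by apply: le_trans M0; rewrite nmulr_rle0.
    apply: le_trans kM; apply: (@le_trans _ _ (h * k0)); last by rewrite lerDl.
    by rewrite mulrC ler_wpM2r.
  rewrite (intge _ (ltW hs) st); apply: le_trans kM; rewrite lerD2l; apply: H1.
  by apply/andP; split; lra.
- rewrite costE intge//; apply: le_trans kM; rewrite -addrA lerD2l.
  (* If [h = t], the end point is the value at the junction, which is the start of the tail. *)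
  apply: le_trans H2; rewrite lerD2l; move: ht; rewrite le_eqVlt => /orP[/eqP ht|ht].
    rewrite -ht splice_mid subrr.
    by case: con => [[_ _ ->]].
  by rewrite splice_gt.
Qed.

(** Equal to [c^2 / 4 - 1], which may have either sign; its absolute value is therefore used in
    estimates. *)
Definition stay_cost : R := affine_cost 0 0 0.

Lemma affine_control_stay x h : half_plane R x -> affine_control x h 0 0 0.
Proof. by move=> hx; split => //; rewrite scaler0 addr0. Qed.

Lemma level_exists x t : half_plane R x -> 0 <= t -> exists M, admissible_level x t M.
Proof.
move=> hx t0; exists (Num.max 0 (t * stay_cost + g0 x)).
apply: (@level_step x t t _ (g0 x) 0 0 0) => //.
- exact: affine_control_stay.
- by rewrite scaler0 addr0 subrr; exact: level0.
- by rewrite le_max lexx.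
- by rewrite le_max lexx orbT.
Qed.

Lemma has_inf_level x t : half_plane R x -> 0 <= t ->
  has_inf [set M | admissible_level x t M].
Proof.
move=> hx t0; split; first by have [M] := level_exists hx t0; exists M.
by exists 0 => M; exact: level_ge0.
Qed.

Lemma path_value_le x t M : 0 <= t -> admissible_level x t M -> path_value x t <= M.
Proof. by move=> t0 lev; apply: ge_inf => //; exists 0 => M'; exact: level_ge0. Qed.

Lemma path_value_lt x t M : half_plane R x -> 0 <= t -> path_value x t < M ->
  admissible_level x t M.
Proof.
move=> hx t0 /(inf_lt (proj1 (has_inf_level hx t0)))[M' lev M'M].
by apply: level_le lev; exact: ltW.
Qed.

Lemma path_value_ge0 x t : half_plane R x -> 0 <= t -> 0 <= path_value x t.
Proof.
move=> hx t0; apply: lb_le_inf; first by have [M] := level_exists hx t0; exists M.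
by move=> M; exact: level_ge0.
Qed.

Lemma path_value0 x : half_plane R x -> path_value x 0 = g0 x.
Proof.
move=> hx; apply/eqP; rewrite eq_le; apply/andP; split.
  by apply: path_value_le => //; exact: level0.
apply: lb_le_inf; first by have [M] := @level_exists x 0 hx (lexx 0); exists M.
move=> M [gamma [eta [l [[[_ _ gx] _] _ _]]]].
by rewrite Rintegral_itv0 add0r gx.
Qed.

(** One half of dynamic programming. The maximum with 0 is the option of stopping at once. *)
Lemma path_value_step x t h (v eta : R * R) (l : R) : half_plane R x ->
  0 <= h -> h <= t -> affine_control x h v eta l ->
  path_value x t <=
  Num.max 0 (h * affine_cost v eta l + path_value (x + h *: v) (t - h)).
Proof.
move=> hx h0 ht ac; apply/ler_addgt0Pr => e e0.
apply: path_value_le; first exact: le_trans ht.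
apply: (@level_step x t h _ (path_value (x + h *: v) (t - h) + e)) => //.
- exact: ac.
- apply: path_value_lt; [by case: ac|by rewrite subr_ge0|by rewrite ltrDl].
- by apply: addr_ge0; [rewrite le_max lexx|exact: ltW].
- by rewrite addrA lerD2r le_max lexx orbT.
Qed.

(** The other half of dynamic programming: the remainder of the control keeps the level diminished
    by the cost already spent. *)
Lemma level_tail x t M h gamma eta l : 0 <= h -> h <= t ->
  control a b x t gamma eta l ->
  mu.-integrable `[0, t] (fun s => (cost gamma eta l s)%:E) ->
  (forall s, 0 <= s <= t -> \int[mu]_(r in `[0, s]) cost gamma eta l r <= M) ->
  \int[mu]_(r in `[0, t]) cost gamma eta l r + g0 (gamma t) <= M ->
  path_value (gamma h) (t - h) <= M - \int[mu]_(r in `[0, h]) cost gamma eta l r.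
Proof.
move=> h0 ht con ik H1 H2; apply: path_value_le; first by rewrite subr_ge0.
exists (fun r => gamma (r + h)), (fun r => eta (r + h)), (fun r => l (r + h)).
have costE : cost (fun r => gamma (r + h)) (fun r => eta (r + h))
    (fun r => l (r + h)) = (fun s => cost gamma eta l (s + h)).
  by apply/funext => s; rewrite running_cost_shift.
have intE s : 0 <= s -> s <= t - h ->
    \int[mu]_(r in `[0, s]) cost gamma eta l (r + h) =
    \int[mu]_(r in `[0, s + h]) cost gamma eta l r -
    \int[mu]_(r in `[0, h]) cost gamma eta l r.
  move=> s0 sth.
  have ikh : mu.-integrable `[0 + h, s + h] (fun r => (cost gamma eta l r)%:E).
    by apply: integrable_itvS ik; lra.
  have iks : mu.-integrable `[0, s + h] (fun r => (cost gamma eta l r)%:E).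
    by apply: integrable_itvS ik; lra.
  have hsh : h <= s + h by rewrite lerDr.
  rewrite (Rintegral_itv_cat h0 hsh iks) (Rintegral_shift ikh) add0r.
  by rewrite [RHS]addrC addKr.
split.
- exact: control_tail con.
- by rewrite costE; apply: integrable_shift; apply: integrable_itvS ik; lra.
- move=> s /andP[s0 st]; rewrite costE (intE _ s0 st) lerD2r; apply: H1.
  by apply/andP; split; lra.
- have th0 : 0 <= t - h by rewrite subr_ge0.
  by rewrite costE (intE _ th0 (lexx _)) subrK addrAC lerD2r.
Qed.

(** Duality with the four vectors [(k, 0)], [(-k, 0)], [(0, k)], [(0, -k)], which suffice for the
    max norm. [C] is the largest of the four constants from [running_cost_coercive]. With [k] the
    Lipschitz constant of [g0] this compares final payoffs; with [k] large it confines paths. *)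
Lemma displacement_bound (k : R) : 0 <= k -> exists2 C : R, 0 <= C &
  forall x t gamma eta l s0 s1, 0 <= s0 -> s0 <= s1 -> s1 <= t ->
  control a b x t gamma eta l ->
  mu.-integrable `[0, t] (fun s => (cost gamma eta l s)%:E) ->
  k * `|gamma s1 - gamma s0| <=
    \int[mu]_(r in `[s0, s1]) cost gamma eta l r + C * (s1 - s0).
Proof.
move=> k0; pose C := k ^+ 2 + c * k + 1 + (a * k ^+ 2 + b * k) ^+ 2.
have ck0 : 0 <= c * k by rewrite mulr_ge0// ltW.
exists C; first by rewrite addr_ge0 ?sqr_ge0// addr_ge0// addr_ge0// sqr_ge0.
move=> x t gamma eta l s0 s1 h0 h01 h1 con ik.
have key (P : R * R) : Hamiltonian c P + (a * P.1 ^+ 2 + b * P.1) ^+ 2 <= C ->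
    - (P.1 * ((gamma s1).1 - (gamma s0).1) + P.2 * ((gamma s1).2 - (gamma s0).2)) <=
    \int[mu]_(r in `[s0, s1]) cost gamma eta l r + C * (s1 - s0).
  move=> PC; have := @control_duality _ a b c x t gamma eta l s0 s1 P (- C)
    h0 h01 h1 con ik.
  have H s (p : R * R) : s0 < s < s1 ->
     derive1 gamma s = p -> 0 <= l s -> (l s = 0 -> p = eta s) ->
     (l s <> 0 -> (eta s).2 = p.2 - l s) -> (l s <> 0 -> p.2 = 0) ->
     (l s <> 0 -> (gamma s).2 = 0) ->
     - C <= cost gamma eta l s + P.1 * p.1 + P.2 * p.2.
    move=> _ dg l0 lE lN lP _.
    have := @running_cost_coercive _ a b c a_gt0 gamma eta l s P p dg l0 lE lN lP.
    by apply: le_trans; rewrite lerN2.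
  by move=> /(_ H); rewrite mulNr; lra.
have C1 : Hamiltonian c (k, 0) + (a * k ^+ 2 + b * k) ^+ 2 <= C.
  by rewrite /Hamiltonian /C /=; lra.
(* Four times this is the difference of the squares of [a k^2 + b k] and [a k^2 - b k]. *)
have k3 : 0 <= a * b * k ^+ 3 by rewrite !mulr_ge0 ?exprn_ge0// ltW.
have C2 : Hamiltonian c (- k, 0) + (a * (- k) ^+ 2 + b * (- k)) ^+ 2 <= C.
  by rewrite /Hamiltonian /C /=; lra.
have C0 : 0 <= (a * k ^+ 2 + b * k) ^+ 2 by exact: sqr_ge0.
have C3 : Hamiltonian c (0, k) + (a * 0 ^+ 2 + b * 0) ^+ 2 <= C.
  by rewrite /Hamiltonian /C /=; lra.
have C4 : Hamiltonian c (0, - k) + (a * 0 ^+ 2 + b * 0) ^+ 2 <= C.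
  by rewrite /Hamiltonian /C /=; lra.
have := key _ C1; have := key _ C2; have := key _ C3; have := key _ C4 => /=.
set A := _ + C * _; set D1 := (gamma s1).1 - _; set D2 := (gamma s1).2 - _.
rewrite !mul0r !addr0 !add0r !mulNr !opprK => K4 K3 K2 K1.
have aux D : k * D <= A -> - (k * D) <= A -> k * `|D| <= A.
  by case: (ger0P D) => _ ? ?; rewrite ?mulrN.
rewrite prod_normE maxr_pMr// ge_max /= -/D1 -/D2.
by apply/andP; split; apply: aux.
Qed.

Variable Lip : R.
Hypothesis Lip_ge0 : 0 <= Lip.
Hypothesis g0_Lip : forall x y, half_plane R x -> half_plane R y ->
  `|g0 x - g0 y| <= Lip * `|x - y|.

(** For the lower bound of [W(x, t + s)], a nearly optimal control is cut at time [t]: the change of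
    [g0] between [gamma t] and [gamma (t + s)] is paid by the omitted cost, up to [C1 * s]. For the
    upper bound the path waits at [x] for time [s]. *)
Lemma path_value_time : exists2 C : R, 0 <= C & forall x t s, half_plane R x ->
  0 <= t -> 0 <= s -> `|path_value x (t + s) - path_value x t| <= C * s.
Proof.
have [C1 C10 disp] := displacement_bound Lip_ge0.
exists (C1 + `|stay_cost|); first by rewrite addr_ge0.
move=> x t s hx t0 s0; have ts0 : 0 <= t + s by rewrite addr_ge0.
have tts : t <= t + s by rewrite lerDl.
rewrite ler_norml; apply/andP; split.
  rewrite lerBrDr addrC lerBlDr; apply/ler_addgt0Pr => e e0.
  have [|gamma [eta [l [con ik H1 H2]]]] := @path_value_lt x (t + s)
    (path_value x (t + s) + e) hx ts0; first by rewrite ltrDl.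
  apply: path_value_le => //; exists gamma, eta, l; split.
  - exact: control_prefix con.
  - exact: integrable_itvS ik.
  - move=> r /andP[r0 rt].
    have /le_trans -> // : \int[mu]_(r in `[0, r]) cost gamma eta l r <=
        path_value x (t + s) + e by apply: H1; rewrite r0 (le_trans rt).
    by rewrite addrAC lerDl mulr_ge0 // addr_ge0.
  - have := disp x (t + s) gamma eta l t (t + s) t0 tts (lexx _) con ik.
    have -> : t + s - t = s by ring.
    move=> D.
    have hp r : 0 <= r <= t + s -> half_plane R (gamma r).
      by case: con => [[_ H _] _]; exact: H.
    have := @g0_Lip (gamma t) (gamma (t + s)) (hp _ _) (hp _ _).
    rewrite t0 tts ts0 lexx => /(_ isT isT); rewrite distrC.
    move: H2; rewrite (Rintegral_itv_cat t0 tts ik).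
    rewrite ler_norml distrC => H2 /andP[G1 G2].
    have : 0 <= `|stay_cost| * s by rewrite mulr_ge0.
    by rewrite mulrDl; lra.
rewrite lerBlDr; have := @path_value_step x (t + s) s 0 0 0 hx s0.
rewrite lerDr => /(_ t0 (affine_control_stay s hx)) /le_trans; apply.
rewrite scaler0 addr0 addrK ge_max; apply/andP; split.
  by rewrite addr_ge0 ?path_value_ge0// mulr_ge0// addr_ge0.
rewrite lerD2r mulrC; apply: (@le_trans _ _ (`|stay_cost| * s)).
  by rewrite ler_wpM2r// ler_norm.
by rewrite ler_wpM2r// lerDr.
Qed.

Lemma affine_cost_unit (v : R * R) : `|v| <= 1 ->
  affine_cost v v 0 <= ((1 + c) ^+ 2 + 1) / 4.
Proof.
case: v => v1 v2; rewrite prod_normE ge_max !ler_norml /=.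
move=> /andP[/andP[h1 h2] /andP[h3 h4]].
rewrite /affine_cost ltxx addr0 LagrangianN /=.
have : 0 <= (1 - v1) * (1 + v1 + 2 * c).
  by have := c_gt0 => ?; apply: mulr_ge0; lra.
have : 0 <= (1 - v2) * (1 + v2) by apply: mulr_ge0; lra.
lra.
Qed.

(** Go straight from [x] to [x'] at unit speed, then continue from [x']; the time used up is
    accounted for by [path_value_time]. Hence the condition that the distance be at most [t]. *)
Lemma path_value_space : exists2 C : R, 0 <= C & forall x x' t,
  half_plane R x -> half_plane R x' -> `|x' - x| <= t ->
  path_value x t <= path_value x' t + C * `|x' - x|.
Proof.
have [C C0 HC] := path_value_time.
pose K := ((1 + c) ^+ 2 + 1) / 4.
have K0 : 0 <= K by rewrite divr_ge0// addr_ge0// sqr_ge0.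
exists (C + K); first by rewrite addr_ge0.
move=> x x' t hx hx'; set d := `|x' - x| => dt.
have d0 : 0 <= d by exact: normr_ge0.
have t0 : 0 <= t by exact: le_trans dt.
have [d00|dn0] := eqVneq d 0.
  have -> : x' = x by apply/eqP; rewrite -subr_eq0 -normr_eq0 -/d d00.
  by rewrite d00 mulr0 addr0.
pose v := d^-1 *: (x' - x).
have xv : x + d *: v = x' by rewrite /v scalerA divff// scale1r addrC subrK.
have nv : `|v| = 1 by rewrite normrZ gtr0_norm ?invr_gt0 ?lt_def ?dn0// mulVf.
have acv : affine_control x d v v 0 by split => //; rewrite xv.
have := path_value_step hx d0 dt acv; rewrite xv => /le_trans; apply.
rewrite ge_max; apply/andP; split.
  by rewrite addr_ge0 ?path_value_ge0// mulr_ge0// addr_ge0.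
have vK : affine_cost v v 0 <= K by apply: affine_cost_unit; rewrite nv.
have td0 : 0 <= t - d by rewrite subr_ge0.
have := HC x' (t - d) d hx' td0 d0; rewrite subrK ler_norml => /andP[+ _].
have : d * affine_cost v v 0 <= K * d by rewrite mulrC ler_wpM2r.
by rewrite mulrDl; lra.
Qed.

End value.

(** * Identification with the upper value *)

Section running_cost_integrability.
Context {R : realType}.
Local Notation mu := (@lebesgue_measure R).
Variables (a b c : R) (g0 : R * R -> R).
Hypotheses (a_gt0 : 0 < a) (b_gt0 : 0 < b) (c_gt0 : 0 < c).
Hypothesis g0_gt0 : forall x, half_plane R x -> 0 < g0 x.
Implicit Types (x : R * R) (t h s M : R) (gamma eta : R -> R * R) (l : R -> R).
Local Notation cost := (running_cost a b c).
Local Notation W := (path_value a b c g0).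

Lemma ae_exists_oo (P : R -> Prop) (p q : R) : {ae mu, forall s, P s} ->
  p < q -> exists2 r, p < r < q & P r.
Proof.
move=> [N [mN N0 PN]] pq; apply: contrapT => noP.
have sub : `]p, q[%classic `<=` N.
  move=> r /=; rewrite in_itv /= => rI; apply: PN => /= Pr.
  by apply: noP; exists r.
have : (mu `]p, q[%classic <= mu N)%E by apply: le_measure; rewrite ?inE.
rewrite N0 lebesgue_measure_itv /= lte_fin pq -EFinB lee_fin leNgt.
by rewrite subr_gt0 pq.
Qed.

Lemma ac_continuous_at (s r0 e : R) gamma : absolutely_continuous_on 0 s gamma ->
  0 <= r0 -> r0 <= s -> 0 < e -> exists2 d, 0 < d &
  forall r, 0 <= r -> r <= s -> `|r - r0| < d -> `|gamma r - gamma r0| < e.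
Proof.
move=> ac r00 r0s e0; have [d d0 H] := ac _ e0; exists d => // r r1 rs.
have H' u v : 0 <= u -> u <= v -> v <= s -> v - u < d -> `|gamma v - gamma u| < e.
  move=> u0 uv vs uvd; have := H 1%N (fun=> u) (fun=> v).
  rewrite !big_ord1; apply => //.
  by move=> i j; rewrite !ord1.
have [rr0|rr0] := leP r r0.
  by rewrite distrC ger0_norm ?subr_ge0// => rd; rewrite distrC; exact: H'.
by rewrite gtr0_norm ?subr_gt0// => rd; apply: H' => //; exact: ltW.
Qed.

(** Stopping rules see paths up to null sets, while [control_mix] needs equality everywhere. At
    [s = 0] the almost everywhere condition is void and the common starting point decides. *)
Lemma ac_eq_ae s gamma gamma' : absolutely_continuous_on 0 s gamma ->
  absolutely_continuous_on 0 s gamma' -> gamma 0 = gamma' 0 ->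
  {ae mu, forall r, 0 <= r <= s -> gamma r = gamma' r} ->
  forall r, 0 <= r <= s -> gamma r = gamma' r.
Proof.
move=> ac ac' g00 gg' r0 /andP[r00 r0s].
have [s0|s0] := leP s 0.
  suff -> : r0 = 0 by [].
  by apply/eqP; rewrite eq_le r00 (le_trans r0s).
apply: contrapT => /eqP neq.
have e0 : 0 < `|gamma r0 - gamma' r0| / 2 by rewrite divr_gt0// normr_gt0 subr_eq0.
have [d1 d10 H1] := ac_continuous_at ac r00 r0s e0.
have [d2 d20 H2] := ac_continuous_at ac' r00 r0s e0.
pose d := Num.min d1 d2; have d0 : 0 < d by rewrite lt_min d10.
have pq : Num.max 0 (r0 - d) < Num.min s (r0 + d).
  rewrite gt_max !lt_min.
  by apply/andP; split; apply/andP; split; lra.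
have [r /andP[]] := ae_exists_oo gg' pq.
rewrite gt_max lt_min => /andP[r1 r2] /andP[r3 r4] grr.
have rd : `|r - r0| < d by rewrite ltr_norml; apply/andP; split; lra.
have rI : 0 <= r <= s by rewrite !ltW.
have := H1 r (ltW r1) (ltW r3); have := H2 r (ltW r1) (ltW r3).
move: rd; rewrite lt_min => /andP[-> ->] /(_ isT) h2 /(_ isT) h1.
have : `|gamma r0 - gamma' r0| < `|gamma r0 - gamma' r0|.
  rewrite [X in _ < X]splitr.
  apply: le_lt_trans (ltrD h1 h2); rewrite (distrC (gamma r)) (grr rI).
  by rewrite -[X in `|X|](subrKA (gamma' r)); exact: ler_normD.
by rewrite ltxx.
Qed.

Lemma sub_lty (p q : \bar R) : (0 <= q -> q < +oo -> p - q < +oo -> p < +oo)%E.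
Proof. by case: q => [q| |]; case: p => [p| |]//= _ _ _; rewrite ltry. Qed.

(** The cost is at least -1, so its negative part always has a finite integral, and a finite total
    bounds the positive part. *)
Lemma integrable_running_cost x t gamma eta l : control a b x t gamma eta l ->
  (\int[mu]_(s in `[0%R, t]) (cost gamma eta l s)%:E < +oo)%E ->
  mu.-integrable `[0, t] (fun s => (cost gamma eta l s)%:E).
Proof.
move=> con lty; have mk := measurable_running_cost c con.
have mk' : measurable_fun `[0, t] (fun s => (cost gamma eta l s)%:E).
  exact/measurable_EFinP.
have neg : (\int[mu]_(s in `[0%R, t]) ((fun s => (cost gamma eta l s)%:E)^\- s) < +oo)%E.
  apply: (@le_lt_trans _ _ (\int[mu]_(s in `[0%R, t]) 1%E)%E).
    apply: ge0_le_integral => //; first exact: measurable_funeneg.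
    move=> s _; rewrite funenegE ge_max lee01 andbT -EFinN lee_fin.
    by rewrite lerNl; exact: running_cost_ge.
  rewrite integral_cst//= mul1e lebesgue_measure_itv /=.
  by case: ifP => _; rewrite -?EFinB ltry.
have pos : (\int[mu]_(s in `[0%R, t]) ((fun s => (cost gamma eta l s)%:E)^\+ s) < +oo)%E.
  apply: sub_lty neg _; last by rewrite -integralE.
  by apply: integral_ge0 => s _; exact: funeneg_ge0.
apply/integrableP; split => //.
have mp := measurable_funepos mk'; have mn := measurable_funeneg mk'.
apply: (@le_lt_trans _ _ (\int[mu]_(s in `[0%R, t])
  ((fun s => (cost gamma eta l s)%:E)^\+ s +
   (fun s => (cost gamma eta l s)%:E)^\- s))%E).
  apply: ge0_le_integral => //.
  - exact: measurableT_comp.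
  - exact: emeasurable_funD.
  - move=> s _; have /(congr1 (fun F => F s)) /= -> // :=
      fune_abse (fun s => (cost gamma eta l s)%:E).
by rewrite ge0_integralD//; exact: lte_add_pinfty.
Qed.

End running_cost_integrability.

(** * Cheaper controls along a path and the stopping rule of the maximizer *)

Section costly_stopping.
Context {R : realType}.
Local Notation mu := (@lebesgue_measure R).
Variables (a b c : R) (g0 : R * R -> R).
Hypotheses (a_gt0 : 0 < a) (b_gt0 : 0 < b) (c_gt0 : 0 < c).
Hypothesis g0_gt0 : forall x, half_plane R x -> 0 < g0 x.
Implicit Types (x : R * R) (t h s M : R) (gamma eta : R -> R * R) (l : R -> R).
Local Notation cost := (running_cost a b c).
Local Notation W := (path_value a b c g0).

Lemma control_cheaper x t s0 gamma eta l gamma' eta' l' :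
  0 <= s0 -> s0 <= t ->
  control a b x t gamma eta l -> control a b x s0 gamma' eta' l' ->
  mu.-integrable `[0, t] (fun s => (cost gamma eta l s)%:E) ->
  mu.-integrable `[0, s0] (fun s => (cost gamma' eta' l' s)%:E) ->
  (forall r, 0 <= r <= s0 -> gamma r = gamma' r) ->
  exists eta1 l1, [/\ control a b x t gamma eta1 l1,
    mu.-integrable `[0, t] (fun s => (cost gamma eta1 l1 s)%:E),
    forall s, 0 <= s <= t -> \int[mu]_(r in `[0, s]) cost gamma eta1 l1 r <=
                             \int[mu]_(r in `[0, s]) cost gamma eta l r &
    \int[mu]_(r in `[0, s0]) cost gamma eta1 l1 r <=
    \int[mu]_(r in `[0, s0]) cost gamma' eta' l' r].
Proof.
move=> s00 s0t con con' ik ik' gg'.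
pose D : set R := `]0, s0[ `&` [set s | cost gamma' eta' l' s < cost gamma eta l s].
have mk : measurable_fun `]0, s0[ (cost gamma eta l).
  apply: measurable_funS (measurable_running_cost c con) => //.
  by move=> r /=; rewrite !in_itv /= => /andP[/ltW -> /ltW/le_trans->].
have mk' : measurable_fun `]0, s0[ (cost gamma' eta' l').
  apply: measurable_funS (measurable_running_cost c con') => //.
  by move=> r /=; rewrite !in_itv /= => /andP[/ltW -> /ltW].
have mD : measurable D.
  rewrite (_ : D = `]0, s0[ `&`
    (fun s => cost gamma' eta' l' s < cost gamma eta l s) @^-1` [set true]) //.
  by apply: (measurable_fun_ltr mk' mk).
have D0 : D `<=` `]0, s0[ by move=> r [].
exists (fun r => if r \in D then eta' r else eta r),
  (fun r => if r \in D then l' r else l r).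
have con1 := control_mix s00 s0t mD D0 con con' gg'.
have costE := running_cost_mix a b c eta l eta' l' _ D0 gg'.
set k1 := cost gamma _ _ in costE *.
have k1le s : k1 s <= cost gamma eta l s.
  by rewrite costE; case: ifPn => // /set_mem[_ /ltW].
have k1le' s : 0 < s < s0 -> k1 s <= cost gamma' eta' l' s.
  move=> sI; rewrite costE; case: ifPn => // /negP nD.
  rewrite leNgt; apply/negP => lt; apply: nD; apply/mem_set.
  by split => //=; rewrite in_itv.
have ik1 : mu.-integrable `[0, t] (fun s => (k1 s)%:E).
  have i1 : mu.-integrable `[0, t] (fun s => (`|cost gamma eta l s| + 1)%:E).
    exact: (integrableD _ (integrable_norm ik) (integrable_cst_itv _ _ 1)).
  apply: le_integrable i1 => //.
    by apply/measurable_EFinP; exact: (measurable_running_cost c con1).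
  move=> s _ /=; rewrite lee_fin [leRHS]ger0_norm ?addr_ge0//.
  have := @running_cost_ge _ a b c a_gt0 gamma (fun r => if r \in D then eta' r else eta r)
    (fun r => if r \in D then l' r else l r) s; rewrite -/k1 => k1ge.
  have := k1le s; have := ler_norm (cost gamma eta l s).
  have := normr_ge0 (cost gamma eta l s).
  by move=> h1 h2 h3; rewrite ler_norml; apply/andP; split; lra.
split.
- exact: con1.
- exact: ik1.
- move=> s /andP[s1 st]; apply: le_Rintegral.
  + exact: measurable_itv.
  + exact: integrable_itvS ik1.
  + exact: integrable_itvS ik.
  + by move=> r _; exact: k1le.
- have iko : mu.-integrable `[0, s0] (fun s => (k1 s)%:E) by exact: integrable_itvS ik1.
  have sub : (`]0, s0[ : set R) `<=` `[0, s0] by exact: subset_itv_oo_cc.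
  have sub1 : (`[0, s0[ : set R) `<=` `[0, s0].
    by move=> r /=; rewrite !in_itv /= => /andP[-> /ltW].
  rewrite -Rintegral_itv_bndo_bndc; last exact: integrableS iko.
  rewrite -[leRHS]Rintegral_itv_bndo_bndc; last exact: integrableS ik'.
  rewrite -Rintegral_itv_obnd_cbnd; last exact: integrableS iko.
  rewrite -[leRHS]Rintegral_itv_obnd_cbnd; last exact: integrableS ik'.
  apply: le_Rintegral.
  + exact: measurable_itv.
  + exact: integrableS iko.
  + exact: integrableS ik'.
  + by move=> r /=; rewrite in_itv /= => /k1le'.
Qed.

(** A search ends at its first success, so agreement up to and including that index is enough. This
    is the discrete form of the stopping time property. *)
Lemma find_iota_eq (p q : pred nat) N :
  (forall i, (i <= find p (iota 0 N))%N -> p i = q i) ->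
  find p (iota 0 N) = find q (iota 0 N).
Proof.
have find_le (r : pred nat) : (find r (iota 0 N) <= N)%N.
  by have := find_size r (iota 0 N); rewrite size_iota.
have nf (r : pred nat) i : (i < find r (iota 0 N))%N -> r i = false.
  move=> ir; have iN := leq_trans ir (find_le r).
  by have := before_find 0%N ir; rewrite nth_iota.
have yf (r : pred nat) : (find r (iota 0 N) < N)%N -> r (find r (iota 0 N)).
  move=> rN; have := nth_find 0%N (_ : has r (iota 0 N)).
  by rewrite has_find size_iota rN nth_iota// => ->.
move=> pq; case: (ltngtP (find p (iota 0 N)) (find q (iota 0 N))) => // lt.
  have pN := leq_trans lt (find_le q).
  by have := pq _ (leqnn _); rewrite (yf p pN) (nf q _ lt).
have qN := leq_trans lt (find_le p).
by have := pq _ (ltnW lt); rewrite (yf q qN) (nf p _ lt).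
Qed.

(* The condition on the path under which the maximizer stops: it involves only
   the class of [gamma] on [[0, s]], and not the unobserved [(eta, l)]. *)
Definition costly (x : R * R) (m : R) gamma (s : R) : Prop :=
  forall gamma' eta l, control a b x s gamma' eta l ->
    {ae mu, forall r, 0 <= r <= s -> gamma' r = gamma r} ->
    (m%:E <= \int[mu]_(r in `[0%R, s]) (cost gamma' eta l r)%:E)%E.

(** The search covers the indices below [N]. Without success [find] returns [N], so that the rule
    then stops at the final time [N * d], where [g0] is collected. *)
Definition costly_step (x : R * R) (m d : R) (N : nat) gamma : nat :=
  find (fun i => `[< costly x m gamma (i%:R * d) >]) (iota 0 N).

Definition costly_time x m d N gamma : R := (costly_step x m d N gamma)%:R * d.

Lemma costly_ae x m s gamma gamma' :
  {ae mu, forall r, 0 <= r <= s -> gamma r = gamma' r} ->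
  costly x m gamma s -> costly x m gamma' s.
Proof.
move=> gg' H gamma1 eta l con g1; apply: (H gamma1 eta l con).
by apply: aeS (aeI gg' g1) => r [h1 h2] rs; rewrite h2// h1.
Qed.

Lemma costly_time_stopping x m d N : 0 <= d ->
  stopping_time (costly_time x m d N).
Proof.
move=> d0; split=> [gamma _|gamma gamma' s _ _ s0 gg' ths].
  by rewrite /costly_time mulr_ge0.
rewrite /costly_time /costly_step; congr (_%:R * _); apply: find_iota_eq.
move=> i ile; have ids : i%:R * d <= s.
  by apply: le_trans ths; rewrite /costly_time ler_wpM2r// ler_nat.
have sub : {ae mu, forall r, 0 <= r <= i%:R * d -> gamma r = gamma' r}.
  by apply: aeS gg' => r H /andP[r0 rd]; apply: H; rewrite r0 (le_trans rd).
apply/asboolP/asboolP; apply: costly_ae => //.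
by apply: aeS sub => r H /H.
Qed.

End costly_stopping.

(** * Equality of the upper value and the path value *)

Section identification.
Context {R : realType}.
Local Notation mu := (@lebesgue_measure R).
Variables (a b c : R) (g0 : R * R -> R).
Hypotheses (a_gt0 : 0 < a) (b_gt0 : 0 < b) (c_gt0 : 0 < c).
Hypothesis g0_gt0 : forall x, half_plane R x -> 0 < g0 x.
Implicit Types (x : R * R) (t h s M : R) (gamma eta : R -> R * R) (l : R -> R).
Local Notation cost := (running_cost a b c).
Local Notation W := (path_value a b c g0).

Lemma extendE t gamma r : 0 <= r <= t -> extend t gamma r = gamma r.
Proof. by move=> rt; rewrite /extend patchE mem_set//= in_itv. Qed.

Lemma integral_EFinE (s : R) (f : R -> R) :
  mu.-integrable `[0, s] (fun s => (f s)%:E) ->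
  (\int[mu]_(r in `[0%R, s]) (f r)%:E = (\int[mu]_(r in `[0, s]) f r)%:E)%E.
Proof. by move=> fi; rewrite /Rintegral fineK//; exact: integrable_fin_num. Qed.

Lemma not_costly x m s t gamma : 0 <= s -> s <= t ->
  absolutely_continuous_on 0 t gamma -> gamma 0 = x ->
  ~ costly a b c x m (extend t gamma) s ->
  exists gamma' eta l, [/\ control a b x s gamma' eta l,
    mu.-integrable `[0, s] (fun s => (cost gamma' eta l s)%:E),
    \int[mu]_(r in `[0, s]) cost gamma' eta l r < m &
    forall r, 0 <= r <= s -> gamma r = gamma' r].
Proof.
move=> s0 st ac gx nc; apply: contrapT => H; apply: nc => gamma' eta l con gg'.
rewrite leNgt; apply/negP => lt; apply: H; exists gamma', eta, l.
have ik : mu.-integrable `[0, s] (fun s => (cost gamma' eta l s)%:E).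
  apply: integrable_running_cost con _ => //; exact: lt_trans lt (ltry _).
split => //; first by rewrite -lte_fin -integral_EFinE.
have [[ac' _ g'x] _] := con.
apply: ac_eq_ae => //; [exact: ac_onS ac|by rewrite gx|].
apply: aeS gg' => r H rs; rewrite H// extendE//.
by case/andP: rs => -> rs; exact: le_trans st.
Qed.

(** Induction over the grid: each grid time that is not costly supplies a pair cheap up to that
    time, and [control_cheaper] merges it in without raising any earlier partial cost. The path
    never changes, hence neither does [g0 (gamma t)]. *)
Lemma never_costly x t m d N gamma eta l : 0 <= d -> t = N%:R * d ->
  half_plane R x -> control a b x t gamma eta l ->
  mu.-integrable `[0, t] (fun s => (cost gamma eta l s)%:E) ->
  \int[mu]_(r in `[0, t]) cost gamma eta l r + g0 (gamma t) <= m ->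
  (forall i, (i < N)%N -> ~ costly a b c x m (extend t gamma) (i%:R * d)) ->
  W x t <= m + d.
Proof.
move=> d0 tN hx con ik km nc.
have t0 : 0 <= t by rewrite tN mulr_ge0.
have [[ac hp gx] _] := con.
have grid i : (i <= N)%N -> 0 <= i%:R * d <= t.
  by move=> iN; rewrite mulr_ge0//= tN ler_wpM2r// ler_nat.
have [eta1 [l1 [con1 ik1 km1 k1m]]] : exists eta1 l1,
    [/\ control a b x t gamma eta1 l1,
      mu.-integrable `[0, t] (fun s => (cost gamma eta1 l1 s)%:E),
      \int[mu]_(r in `[0, t]) cost gamma eta1 l1 r + g0 (gamma t) <= m &
      forall i, (i < N)%N ->
        \int[mu]_(r in `[0, i%:R * d]) cost gamma eta1 l1 r <= m].
  suff : forall n, (n <= N)%N -> exists eta1 l1,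
      [/\ control a b x t gamma eta1 l1,
        mu.-integrable `[0, t] (fun s => (cost gamma eta1 l1 s)%:E),
        \int[mu]_(r in `[0, t]) cost gamma eta1 l1 r + g0 (gamma t) <= m &
        forall i, (i < n)%N ->
          \int[mu]_(r in `[0, i%:R * d]) cost gamma eta1 l1 r <= m].
    by move=> /(_ N (leqnn N)).
  elim => [|n ih] nN; first by exists eta, l; split.
  have [eta1 [l1 [con1 ik1 km1 k1m]]] := ih (ltnW nN).
  have /andP[s0 st] := grid n (ltnW nN).
  have [gamma' [eta' [l' [con' ik' km' gg']]]] := not_costly s0 st ac gx (nc n nN).
  have [eta2 [l2 [con2 ik2 k21 k2']]] :=
    control_cheaper a_gt0 s0 st con1 con' ik1 ik' gg'.
  exists eta2, l2; split => //.
    by apply: le_trans km1; rewrite lerD2r; apply: k21; rewrite t0 lexx.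
  move=> i; rewrite ltnS leq_eqVlt => /orP[/eqP ->|iltn].
    exact: le_trans k2' (ltW km').
  apply: le_trans (k1m i iltn); apply: k21; apply: grid.
  exact: ltnW (leq_trans iltn (ltnW nN)).
have g0t : 0 < g0 (gamma t) by apply/g0_gt0/hp; rewrite t0 lexx.
have k1m' i : (i <= N)%N -> \int[mu]_(r in `[0, i%:R * d]) cost gamma eta1 l1 r <= m.
  rewrite leq_eqVlt => /orP[/eqP ->|/k1m//]; rewrite -tN.
  by apply: le_trans km1; rewrite lerDl ltW.
have near s : 0 <= s -> s <= t -> exists i, [/\ (i <= N)%N, s <= i%:R * d & i%:R * d <= s + d].
  move=> s0 st; move: d0; rewrite le_eqVlt => /orP[/eqP d0|d0].
    exists N; split => //; rewrite -?tN -?d0 ?addr0//.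
    by rewrite tN -d0 mulr0.
  have sd0 : 0 <= s / d by rewrite divr_ge0// ltW.
  have /andP[i1 i2] := truncn_itv sd0; set i := Num.truncn (s / d) in i1 i2.
  have [iN|Ni] := ltnP i N.
    exists i.+1; split => //.
      by rewrite -ler_pdivrMr// ltW.
    by rewrite -natr1 mulrDl mul1r lerD2r -ler_pdivlMr.
  exists N; split => //; first by rewrite -tN.
  apply: (@le_trans _ _ s); last by rewrite lerDl ltW.
  by apply: le_trans (_ : i%:R * d <= _);
    rewrite -?ler_pdivlMr// ler_pdivlMr// ler_pM2r// ler_nat.
apply: path_value_le => //; exists gamma, eta1, l1; split => //.
  move=> s /andP[s0 st]; have [i [iN si is_]] := near s s0 st.
  have /andP[i0 it] := grid i iN.
  have iki : mu.-integrable `[0, i%:R * d] (fun s => (cost gamma eta1 l1 s)%:E).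
    exact: integrable_itvS ik1.
  have := k1m' i iN; rewrite (Rintegral_itv_cat s0 si iki).
  (* From [s] to the next grid time the cost drops by at most the mesh [d]; this is the [+ d] in the
     conclusion. *)
  have : -1 * (i%:R * d - s) <= \int[mu]_(r in `[s, i%:R * d]) cost gamma eta1 l1 r.
    apply: le_Rintegral_ae => //; first exact: integrable_itvS iki.
    by apply: aeW => r _; exact: running_cost_ge.
  lra.
by apply: le_trans km1 _; rewrite lerDl.
Qed.

Lemma upper_value_le x t : half_plane R x -> 0 <= t ->
  (upper_value a b c g0 x t <= (W x t)%:E)%E.
Proof.
move=> hx t0; apply: ge_ereal_sup => _ [theta [_ ->]].
apply/lee_addgt0Pr => e e0; rewrite -EFinD.
have [|gamma [eta [l [con ik H1 H2]]]] := @path_value_lt _ a b c g0 g0_gt0 x t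
  (W x t + e) hx t0; first by rewrite ltrDl.
have M0 : 0 <= W x t + e by apply: le_trans (H1 0 _); rewrite ?Rintegral_itv0// lexx t0.
apply: (@le_trans _ _ (payoff a b c g0 t theta gamma eta l)).
  by apply: ereal_inf_lbound; exists gamma, eta, l.
rewrite /payoff /=; set T := theta _.
(* [stopping_time] gives a nonnegative value on [L2_path]. A negative [T] would mean an integral
   over an empty interval, and [M0] settles that case. *)
have [T0|T0] := ltP T 0.
  have Tt : T < t by exact: lt_le_trans t0.
  rewrite (min_r (ltW Tt)) (lt_eqF Tt) set_itv_ge; last by rewrite bnd_simp -ltNge.
  by rewrite integral_set0 adde0 lee_fin.
have TI : 0 <= Num.min t T <= t by rewrite le_min t0 T0 ge_min lexx.
have ikT : mu.-integrable `[0, Num.min t T] (fun s => (cost gamma eta l s)%:E).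
  by case/andP: TI => h1 h2; apply: integrable_itvS ik.
rewrite (integral_EFinE ikT) -EFinD lee_fin; case: eqP => Tt; last by rewrite addr0; exact: H1.
by rewrite Tt minxx; exact: H2.
Qed.

Lemma upper_value_ge x t e : half_plane R x -> 0 <= t -> 0 < e ->
  ((W x t - e)%:E <= upper_value a b c g0 x t)%E.
Proof.
move=> hx t0 e0; rewrite le_eqVlt in t0; case/orP: t0 => [/eqP t0|t0].
  (* At time 0 the constant rule 0 stops exactly at [t] and collects [g0]. *)
  rewrite -t0 path_value0//.
  apply: ereal_sup_ge; eexists.
    exists (cst 0); split; last by [].
    by split => //.
  apply: le_ereal_inf_tmp => _ [gamma [eta [l [[[_ _ gx] _] ->]]]].
  rewrite /payoff /= minxx eqxx gx set_itv1 integral_set1 add0e lee_fin.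
  by rewrite gerBl ltW.
pose N := (Num.truncn (t / (e / 2))).+1.
pose d := t / N%:R.
have N0 : 0 < N%:R :> R by rewrite ltr0n.
have d0 : 0 < d by rewrite divr_gt0.
have de : d < e / 2.
  by rewrite ltr_pdivrMr// mulrC -ltr_pdivrMr ?divr_gt0// /N truncnS_gt.
have tN : t = N%:R * d by rewrite /d mulrC divfK// gt_eqF.
apply: ereal_sup_ge; eexists.
  (* The threshold [W - e / 2] and a mesh below [e / 2] fit together: if the rule runs to the end
     against a payoff below [W - e], then [never_costly] yields [W <= W - e / 2 + d < W]. *)
  exists (costly_time a b c x (W x t - e / 2) d N); split; last by [].
  exact: costly_time_stopping (ltW d0).
apply: le_ereal_inf_tmp => _ [gamma [eta [l [con ->]]]].
rewrite /payoff /=; set T := costly_time _ _ _ _ _ _ _ _.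
have mm : ((W x t - e)%:E <= (W x t - e / 2)%:E)%E by rewrite lee_fin; lra.
set n := costly_step a b c x (W x t - e / 2) d N (extend t gamma).
have nN : (n <= N)%N by rewrite -[X in (_ <= X)%N](size_iota 0); exact: find_size.
have TE : T = n%:R * d by [].
have [nlt|Nn] := ltnP n N.
  have Tt : T < t by rewrite TE tN ltr_pM2r// ltr_nat.
  rewrite (min_r (ltW Tt)) (lt_eqF Tt) adde0; apply: le_trans mm _.
  have : costly a b c x (W x t - e / 2) (extend t gamma) T.
    apply/asboolP; rewrite TE.
    have := nth_find 0%N (_ : has (fun i =>
      `[< costly a b c x (W x t - e / 2) (extend t gamma) (i%:R * d) >]) (iota 0 N)).
    by rewrite has_find size_iota -/n => /(_ nlt); rewrite nth_iota.
  have T0 : 0 <= T by rewrite TE mulr_ge0// ltW.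
  (* The control actually played, cut at [T], is one of the competitors in [costly]. *)
  apply; first exact: (control_prefix T0 (ltW Tt) con).
  by apply: aeW => r /andP[r0 rT]; rewrite extendE// r0 (le_trans rT)// ltW.
have nE : n = N by apply/eqP; rewrite eqn_leq nN.
have Tt : T = t by rewrite TE tN nE.
rewrite Tt minxx eqxx leNgt; apply/negP => lt.
have lty : (\int[mu]_(s in `[0%R, t]) (cost gamma eta l s)%:E < +oo)%E.
  by move: lt; rewrite /running_cost; case: integral => //= r _; rewrite ltry.
have ik := integrable_running_cost a_gt0 con lty.
have km : \int[mu]_(r in `[0, t]) cost gamma eta l r + g0 (gamma t) <= W x t - e.
  move: lt; rewrite (integral_EFinE ik).
  by rewrite -EFinD lte_fin => /ltW.
have : W x t <= W x t - e / 2 + d.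
  apply: (@never_costly x t _ d N gamma eta l (ltW d0) tN hx con ik).
    by apply: le_trans km _; lra.
  move=> i iN cst; have : (i < n)%N by rewrite nE.
  move=> /(before_find 0%N); rewrite nth_iota// add0n => /negP; apply.
  exact/asboolP.
lra.
Qed.

Lemma upper_valueE x t : half_plane R x -> 0 <= t ->
  upper_value a b c g0 x t = (W x t)%:E.
Proof.
move=> hx t0; apply/eqP; rewrite eq_le upper_value_le//=.
apply/lee_addgt0Pr => e e0; rewrite -leeBlDr// -EFinB.
exact: upper_value_ge.
Qed.

End identification.

(** * Viscosity properties *)

Section differentiability.
Context {R : realType}.
Implicit Types (phi f : R * R * R -> R) (z w : R * R * R).

Lemma within_continuous_box f z : {within space_time R, continuous f} ->
  space_time R z -> forall e, 0 < e -> exists2 r, 0 < r & forall w,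
  space_time R w -> `|w.1.1 - z.1.1| < r -> `|w.1.2 - z.1.2| < r ->
  `|w.2 - z.2| < r -> `|f w - f z| < e.
Proof.
move=> /subspace_continuousP fc zS e e0.
have /cvgrPdist_lt/(_ _ e0) := fc z zS.
rewrite near_withinE => /nbhs_ballP[r /= r0 H]; exists r => // w wS w1 w2 w3.
rewrite distrC; apply: H => //; split; first split.
all: by rewrite /ball /= distrC.
Qed.

Lemma is_derive_cvg (g : R -> R) (s l : R) :
  h^-1 * (g (s + h) - g s) @[h --> 0^'] --> l -> is_derive s 1 g l.
Proof.
move=> gl.
have gl' : (fun h => h^-1 *: ((g \o shift s) (h *: 1) - g s)) @ 0^' --> l.
  rewrite (_ : (fun h => _) = (fun h => h^-1 * (g (s + h) - g s)))//.
  by apply/funext => h /=; rewrite [h%:A]mulr1 (addrC h).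
apply: DeriveDef; first by apply/cvg_ex; exists l.
by apply/cvg_lim.
Qed.

Lemma increment_bound (g dg : R -> R) (p q D om : R) :
  (forall u, Num.min p q < u < Num.max p q -> is_derive u 1 g (dg u)) ->
  (forall u, Num.min p q < u < Num.max p q -> `|dg u - D| <= om) ->
  {within `[Num.min p q, Num.max p q], continuous g} ->
  `|g q - g p - D * (q - p)| <= om * `|q - p|.
Proof.
wlog pq : p q / p < q.
  move=> H; have [pq|] := boolP (p < q); first exact: H.
  rewrite -leNgt le_eqVlt => /orP[/eqP ->|qp h1 h2 h3].
    by move=> *; rewrite !subrr mulr0 subrr normr0 mulr0.
  move: (H q p qp); rewrite minC maxC => /(_ h1 h2 h3).
  have -> : g p - g q - D * (p - q) = - (g q - g p - D * (q - p)) by ring.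
  by rewrite normrN (distrC p).
rewrite (min_l (ltW pq)) (max_r (ltW pq)) => h1 h2 h3.
have [u uI ->] := MVT pq (fun u (uI : u \in `]p, q[) => h1 u uI) h3.
rewrite -mulrBl normrM ler_wpM2r//; apply: h2.
by move: uI; rewrite in_itv.
Qed.

Lemma is_derive_dx phi z : C1 phi -> space_time R z ->
  is_derive z.1.1 1 (fun u => phi (u, z.1.2, z.2)) (dx phi z).
Proof.
by move=> [H _] /H[d _ _]; rewrite /dx derive1E; exact: derivableP.
Qed.

Lemma is_derive_dt phi z : C1 phi -> space_time R z ->
  is_derive z.2 1 (fun u => phi (z.1.1, z.1.2, u)) (dt phi z).
Proof.
by move=> [H _] /H[_ d _]; rewrite /dt derive1E; exact: derivableP.
Qed.

Lemma is_derive_dy phi z : C1 phi -> space_time R z -> 0 < z.1.2 ->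
  is_derive z.1.2 1 (fun u => phi (z.1.1, u, z.2)) (dy phi z).
Proof.
move=> [H _] /H[_ _ d] y0; apply: is_derive_cvg.
have : dy_quotient phi z --> dy phi z by exact: d.
apply: cvg_trans => A; rewrite /dy_quotient /= => HA.
have near0 : \forall h \near 0^', 0 <= z.1.2 + h.
  near=> h; have : `|h| < z.1.2 by near: h; exact: dnbhs0_lt.
  by have := ler_norm (- h); rewrite normrN; lra.
have HA' : \forall h \near 0^', 0 <= z.1.2 + h ->
    A (h^-1 * (phi (z.1.1, z.1.2 + h, z.2) - phi z)).
  exact: HA.
apply: filterS2 near0 HA' => h h1 /(_ h1).
by move: (z) => [[? ?] ?].
Unshelve. all: by end_near. Qed.

(** The increment is split along x, then y, then t, all intermediate points staying in [space_time];
    on each segment the mean value theorem and continuity of the partial derivative apply. *)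
Lemma C1_differentiable phi z : C1 phi -> space_time R z ->
  forall om, 0 < om -> exists2 r, 0 < r & forall w, space_time R w ->
  `|w.1.1 - z.1.1| < r -> `|w.1.2 - z.1.2| < r -> `|w.2 - z.2| < r ->
  `|phi w - phi z - (dx phi z * (w.1.1 - z.1.1) + dy phi z * (w.1.2 - z.1.2) +
     dt phi z * (w.2 - z.2))| <=
  om * (`|w.1.1 - z.1.1| + `|w.1.2 - z.1.2| + `|w.2 - z.2|).
Proof.
move=> C1phi zS om om0; have [_ [c0 cx cy ct]] := C1phi.
have [r1 r10 H1] := within_continuous_box cx zS om0.
have [r2 r20 H2] := within_continuous_box cy zS om0.
have [r3 r30 H3] := within_continuous_box ct zS om0.
exists (Num.min r1 (Num.min r2 r3)); first by rewrite !lt_min r10 r20.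
case: z zS H1 H2 H3 => [[x y] t] zS H1 H2 H3 [[x' y'] t'] wS /=.
rewrite !lt_min => /and3P[x1 x2 x3] /and3P[y1 y2 y3] /and3P[t1 t2 t3].
have [y0 t0] : 0 <= y /\ 0 < t := zS.
have [y0' t0'] : 0 <= y' /\ 0 < t' := wS.
have between (p q u r : R) : Num.min p q < u < Num.max p q -> `|q - p| < r ->
    `|u - p| < r.
  rewrite /Num.min /Num.max; case: ifP => pq /andP[u1 u2].
    by rewrite gtr0_norm ?subr_gt0// gtr0_norm ?subr_gt0//; lra.
  have qp : q <= p by rewrite leNgt pq.
  by rewrite ler0_norm ?subr_le0// ltr0_norm ?subr_lt0//; lra.
have zero (r : R) : 0 < r -> `|x - x| < r by rewrite subrr normr0.
have X : `|phi (x', y', t') - phi (x, y', t') - dx phi (x, y, t) * (x' - x)| <=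
    om * `|x' - x|.
  apply: (@increment_bound (fun u => phi (u, y', t')) (fun u => dx phi (u, y', t'))).
  - by move=> u uI; apply: (@is_derive_dx phi (u, y', t')).
  - move=> u uI; apply/ltW/(H1 (u, y', t')) => //=; exact: between uI _.
  - apply: continuous_subspaceT => u; apply: differentiable_continuous.
    have [+ _] := @is_derive_dx phi (u, y', t') C1phi wS.
    by move/derivable1_diffP.
have T : `|phi (x, y, t') - phi (x, y, t) - dt phi (x, y, t) * (t' - t)| <=
    om * `|t' - t|.
  have pos u : Num.min t t' < u -> 0 < u.
    by apply: lt_trans; rewrite lt_min t0.
  apply: (@increment_bound (fun u => phi (x, y, u)) (fun u => dt phi (x, y, u))).
  - move=> u /andP[uI _]; apply: (@is_derive_dt phi (x, y, u)) => //.
    by split => //=; exact: pos uI.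
  - move=> u /[dup] uI /andP[u1 _]; apply/ltW/(H3 (x, y, u)) => //=.
    + by split => //=; exact: pos u1.
    + by rewrite subrr normr0.
    + by rewrite subrr normr0.
    + exact: between uI _.
  - apply: continuous_in_subspaceT => u /set_mem /=; rewrite in_itv /= => /andP[u1 _].
    apply: differentiable_continuous.
    have uS : space_time R (x, y, u).
      by split => //=; apply: lt_le_trans u1; rewrite lt_min t0.
    have [+ _] := @is_derive_dt phi (x, y, u) C1phi uS.
    by move/derivable1_diffP.
(* The open segment between [y] and [y'] lies in y > 0, where [dy] is an ordinary derivative; at its
   end points only continuity of [phi] is used. *)
have Y : `|phi (x, y', t') - phi (x, y, t') - dy phi (x, y, t) * (y' - y)| <=
    om * `|y' - y|.
  have pos u : Num.min y y' < u -> 0 < u.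
    by apply: le_lt_trans; rewrite le_min y0.
  apply: (@increment_bound (fun u => phi (x, u, t')) (fun u => dy phi (x, u, t'))).
  - move=> u /andP[uI _]; apply: (@is_derive_dy phi (x, u, t')) => //=.
      by split => //=; exact/ltW/(pos _ uI).
    exact: pos uI.
  - move=> u /[dup] uI /andP[u1 _]; apply/ltW/(H2 (x, u, t')) => //=.
    + by split => //=; exact/ltW/(pos _ u1).
    + by rewrite subrr normr0.
    + exact: between uI _.
  - apply/subspace_continuousP => u /=; rewrite in_itv /= => /andP[u1 u2].
    have uS : space_time R (x, u, t').
      by split => //=; apply: le_trans u1; rewrite le_min y0.
    apply/cvgrPdist_lt => e e0.
    have [r r0 Hr] := within_continuous_box c0 uS e0.
    rewrite near_withinE; exists r => //= s us; rewrite in_itv /= => /andP[s1 s2].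
    rewrite distrC; apply: Hr => //=.
    + by split => //=; apply: le_trans s1; rewrite le_min y0.
    + by rewrite subrr normr0.
    + by rewrite distrC.
    + by rewrite subrr normr0.
set A := dx phi _ * _ in X *; set B := dy phi _ * _ in Y *.
set C := dt phi _ * _ in T *.
rewrite (_ : _ - _ - (A + B + C) = (phi (x', y', t') - phi (x, y', t') - A) +
  (phi (x, y', t') - phi (x, y, t') - B) + (phi (x, y, t') - phi (x, y, t) - C));
  last by ring.
rewrite !mulrDr; apply: le_trans (ler_normD _ _) _; apply: lerD => //.
by apply: le_trans (ler_normD _ _) _; exact: lerD.
Qed.

End differentiability.

(** * Sub- and supersolution tests *)

Section viscosity.
Context {R : realType}.
Local Notation mu := (@lebesgue_measure R).
Variables (a b c : R) (g0 : R * R -> R).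
Hypotheses (a_gt0 : 0 < a) (b_gt0 : 0 < b) (c_gt0 : 0 < c).
Hypothesis g0_gt0 : forall x, half_plane R x -> 0 < g0 x.
Implicit Types (phi : R * R * R -> R) (z w : R * R * R).
Local Notation cost := (running_cost a b c).
Local Notation W := (path_value a b c g0).

(** First-order form of [path_value_step] as h tends to 0. Positivity of [W] at the contact point
    excludes the alternative 0 in the maximum. *)
Lemma affine_cost_subsolution phi z (v eta : R * R) (l h0 : R) :
  C1 phi -> space_time R z -> 0 < W z.1 z.2 ->
  (forall w, space_time R w -> W w.1 w.2 - phi w <= W z.1 z.2 - phi z) ->
  0 < h0 -> (forall h, 0 <= h -> h <= h0 -> affine_control z.1 h v eta l) ->
  dt phi z <= affine_cost a b c v eta l + v.1 * dx phi z + v.2 * dy phi z.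
Proof.
move=> C1phi zS Wz zmax h00 ac; rewrite leNgt; apply/negP => lt.
set E := affine_cost a b c v eta l in lt *.
pose Q := `|v.1| + `|v.2| + 1; have Q0 : 0 < Q by rewrite ltr_wpDl// addr_ge0.
pose del := dt phi z - (E + v.1 * dx phi z + v.2 * dy phi z).
have del0 : 0 < del by rewrite subr_gt0.
(* In time [h] the coordinates change by [h * Q] in total, so the expansion error is at most
   [h * del / 2], half of the assumed gap. *)
have om0 : 0 < del / (2 * Q) by rewrite divr_gt0// mulr_gt0.
have [r r0 Hr] := C1_differentiable C1phi zS om0.
have [zh zt] := zS.
pose h := Num.min h0 (Num.min (z.2 / 2) (r / (2 * Q))).
have h_gt0 : 0 < h by rewrite !lt_min h00 !divr_gt0// mulr_gt0.
have hh0 : h <= h0 by rewrite ge_min lexx.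
have ht : h < z.2.
  rewrite /h !gt_min; apply/orP; right; apply/orP; left.
  by rewrite ltr_pdivrMr// ltr_pMr// ltr1n.
have hr : h * Q < r.
  apply: (@le_lt_trans _ _ (r / 2)); last by rewrite ltr_pdivrMr// ltr_pMr// ltr1n.
  rewrite -ler_pdivlMr// -mulrA -invfM /h.
  by rewrite !ge_min lexx !orbT.
have ach := ac h (ltW h_gt0) hh0.
have := @path_value_step _ a b c g0 g0_gt0 _ _ h v eta l zh (ltW h_gt0) (ltW ht) ach.
rewrite le_max leNgt Wz /= -/E => step.
pose w : R * R * R := (z.1 + h *: v, z.2 - h).
have wS : space_time R w by split; [case: ach|rewrite /= subr_gt0].
have e1 : w.1.1 - z.1.1 = h * v.1 by rewrite /w /= addrC addKr.
have e2 : w.1.2 - z.1.2 = h * v.2 by rewrite /w /= addrC addKr.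
have e3 : w.2 - z.2 = - h by rewrite /w /= addrC addKr.
have := zmax w wS; have := Hr w wS.
rewrite e1 e2 e3 normrN !normrM !(gtr0_norm h_gt0).
have n1 := normr_ge0 v.1; have n2 := normr_ge0 v.2.
have q1 : h * `|v.1| <= h * Q by rewrite ler_pM2l// /Q; lra.
have q2 : h * `|v.2| <= h * Q by rewrite ler_pM2l// /Q; lra.
have q3 : h <= h * Q by rewrite ler_peMr ?(ltW h_gt0)// /Q; lra.
move=> /(_ (le_lt_trans q1 hr) (le_lt_trans q2 hr) (le_lt_trans q3 hr)).
have -> : h * `|v.1| + h * `|v.2| + h = h * Q by rewrite /Q; ring.
have -> : del / (2 * Q) * (h * Q) = h * del / 2 by field; rewrite gt_eqF.
rewrite ler_norml => /andP[_ D] M; rewrite /w /= in M D *.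
have : 0 < h * del by rewrite mulr_gt0.
have dE : h * del = h * dt phi z - (h * E + h * v.1 * dx phi z + h * v.2 * dy phi z).
  by rewrite /del; ring.
have := step; rewrite /w /=; set A := phi _ in M D; set B := W _ _ in M *.
lra.
Qed.

Lemma subsolution_test phi z : C1 phi -> space_time R z -> 0 < W z.1 z.2 ->
  (forall w, space_time R w -> W w.1 w.2 - phi w <= W z.1 z.2 - phi z) ->
  (z.1.2 != 0 -> interior_op c phi z <= 0) /\
  (z.1.2 = 0 -> Num.min (interior_op c phi z) (boundary_op a b phi z) <= 0).
Proof.
move=> C1phi zS Wz zmax.
have key := affine_cost_subsolution C1phi zS Wz zmax.
have [zh zt] := zS; rewrite /half_plane /= in zh.
set p := dx phi z in key *; set q := dy phi z in key *.
have int0 (h0 : R) : 0 < h0 -> (forall h, 0 <= h -> h <= h0 -> 0 <= z.1.2 - h * (2 * q)) ->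
    interior_op c phi z <= 0.
  (* The minimizer of [L(-v) + v_1 p + v_2 q], with minimum [- Hamiltonian (p, q)]. If [q <= 0] it
     points into the half plane and is allowed on the road too. *)
  move=> h00 H; pose v : R * R := (- (2 * p + c), - (2 * q)).
  have := key v v 0 h0 h00; rewrite /affine_cost ltxx LagrangianN /= => K.
  have {K} := K _; rewrite /interior_op -/p -/q => K.
  have : dt phi z <= ((- (2 * p + c) + c) ^+ 2 + (- (2 * q)) ^+ 2) / 4 - 1 + 0 +
      - (2 * p + c) * p + - (2 * q) * q.
    apply: K => h h1 h2; split => //; rewrite /half_plane /=.
    by have := H h h1 h2; rewrite /GRing.scale /= mulrN.
  lra.
split => [z0|z0].
  have zp : 0 < z.1.2 by rewrite lt_neqAle eq_sym z0.
  have Q0 : 0 < `|2 * q| + 1 by rewrite ltr_wpDl.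
  apply: (int0 (z.1.2 / (`|2 * q| + 1))); first by rewrite divr_gt0.
  move=> h h1; rewrite ler_pdivlMr// => h2.
  have : h * (2 * q) <= h * `|2 * q| by rewrite ler_wpM2l// ler_norm.
  lra.
rewrite ge_min; have [q0|q0] := leP q 0.
  apply/orP; left; apply: (int0 1) => // h h1 _; rewrite z0 sub0r -mulrN.
  by rewrite mulr_ge0//; lra.
(* For [q > 0] the optimal velocity would leave the half plane, so its normal part is turned into
   pushing at rate [l]. The horizontal velocity makes the argument of [G] equal to [b + 2 a p], the
   equality case of duality; the test then reads [interior_op + l * boundary_op <= 0]. *)
pose l := 2 * q; have l0 : 0 < l by rewrite mulr_gt0.
pose eta : R * R := (- (2 * p + c), - l).
pose v : R * R := (- (2 * p + c) - l * (b + 2 * a * p), 0).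
have [T0|T0] := leP (interior_op c phi z) 0; first by [].
rewrite /=; rewrite leNgt; apply/negP => B0.
have := key v eta l 1 ltr01; rewrite /affine_cost l0 LagrangianN /= => K.
have : dt phi z <= ((- (2 * p + c) + c) ^+ 2 + (- l) ^+ 2) / 4 - 1 +
    l * G a b ((- (2 * p + c) - (- (2 * p + c) - l * (b + 2 * a * p))) / l) +
    (- (2 * p + c) - l * (b + 2 * a * p)) * p + 0 * q.
  apply: K => h h1 h2; split.
  - exact: ltW.
  - by move=> l00; rewrite l00 ltxx in l0.
  - by [].
  - by rewrite /half_plane /= z0 add0r /GRing.scale /= mulr0.
have -> : G a b ((- (2 * p + c) - (- (2 * p + c) - l * (b + 2 * a * p))) / l) =
    a * p ^+ 2.
  by rewrite /G; field; rewrite !gt_eqF.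
have : 0 < l * boundary_op a b phi z by rewrite mulr_gt0.
move: T0; rewrite /boundary_op /interior_op -/p -/q /l.
lra.
Qed.

(** The quadratic terms are linear in [om] thanks to [om^2 <= om]. *)
Lemma perturbed_Hamiltonian (P : R * R) (om s1 s2 : R) : 0 <= om -> om <= 1 ->
  `|s1| = 1 -> `|s2| = 1 ->
  Hamiltonian c (P.1 - om * s1, P.2 - om * s2) <=
  Hamiltonian c P + om * (2 * `|P.1| + 2 * `|P.2| + 2 + c).
Proof.
move=> om0 om1 n1 n2; rewrite /Hamiltonian /=.
have s11 : s1 ^+ 2 = 1 by rewrite -real_normK ?num_real// n1 expr1n.
have s22 : s2 ^+ 2 = 1 by rewrite -real_normK ?num_real// n2 expr1n.
have h1 : - (om * s1 * P.1) <= om * `|P.1|.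
  by rewrite -mulrA -mulrN ler_wpM2l// (le_trans (ler_norm _))// normrN normrM n1 mul1r.
have h2 : - (om * s2 * P.2) <= om * `|P.2|.
  by rewrite -mulrA -mulrN ler_wpM2l// (le_trans (ler_norm _))// normrN normrM n2 mul1r.
have h3 : - (c * om * s1) <= c * om.
  rewrite -mulrN ler_piMr//; first by rewrite mulr_ge0// ltW.
  by rewrite (le_trans (ler_norm _))// normrN n1.
have h4 : om ^+ 2 <= om by rewrite expr2 ler_piMr.
have -> : (P.1 - om * s1) ^+ 2 = P.1 ^+ 2 - 2 * (om * s1 * P.1) + om ^+ 2.
  transitivity (P.1 ^+ 2 - 2 * (om * s1 * P.1) + om ^+ 2 * s1 ^+ 2); first by ring.
  by rewrite s11 mulr1.
have -> : (P.2 - om * s2) ^+ 2 = P.2 ^+ 2 - 2 * (om * s2 * P.2) + om ^+ 2.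
  transitivity (P.2 ^+ 2 - 2 * (om * s2 * P.2) + om ^+ 2 * s2 ^+ 2); first by ring.
  by rewrite s22 mulr1.
lra.
Qed.

Lemma perturbed_road (P : R * R) (om s1 s2 : R) : 0 <= om -> om <= 1 ->
  `|s1| = 1 -> `|s2| = 1 ->
  road a b (P.1 - om * s1, P.2 - om * s2) <=
  road a b P + om * (2 * a * `|P.1| + a + b + 1).
Proof.
move=> om0 om1 n1 n2; rewrite /road /=.
have s11 : s1 ^+ 2 = 1 by rewrite -real_normK ?num_real// n1 expr1n.
have h1 : - (om * s1 * P.1) <= om * `|P.1|.
  by rewrite -mulrA -mulrN ler_wpM2l// (le_trans (ler_norm _))// normrN normrM n1 mul1r.
have h3 : - (b * om * s1) <= b * om.
  rewrite -mulrN ler_piMr//; first by rewrite mulr_ge0// ltW.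
  by rewrite (le_trans (ler_norm _))// normrN n1.
have h5 : om * s2 <= om by rewrite ler_piMr// (le_trans (ler_norm _))// n2.
have h4 : a * om ^+ 2 <= a * om by rewrite ler_pM2l// expr2 ler_piMr.
have h6 : a * - (om * s1 * P.1) <= a * (om * `|P.1|) by rewrite ler_pM2l.
have -> : (P.1 - om * s1) ^+ 2 = P.1 ^+ 2 - 2 * (om * s1 * P.1) + om ^+ 2.
  transitivity (P.1 ^+ 2 - 2 * (om * s1 * P.1) + om ^+ 2 * s1 ^+ 2); first by ring.
  by rewrite s11 mulr1.
lra.
Qed.

(** Along a nearly optimal control, duality bounds the cost up to time [h] from below, while
    [level_tail] and the minimum bound it from above by a decrement of [phi]. The constants are
    chosen in the order [om], [r], [kap], [C], [h], [eps]. *)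
Lemma supersolution_test phi z : C1 phi -> space_time R z ->
  (forall w, space_time R w -> W z.1 z.2 - phi z <= W w.1 w.2 - phi w) ->
  interior_op c phi z < 0 -> (z.1.2 = 0 -> boundary_op a b phi z < 0) -> False.
Proof.
move=> C1phi zS zmin T0 B0; have [zh zt] := zS.
pose P : R * R := (dx phi z, dy phi z).
have opE : interior_op c phi z = dt phi z + Hamiltonian c P.
  by rewrite /interior_op /Hamiltonian /=; ring.
have roadE : boundary_op a b phi z = road a b P by rewrite /boundary_op /road /=; ring.
rewrite opE in T0; rewrite roadE in B0.
(* The linearization error [om * (|D1| + |D2|)] of [phi] is absorbed in the linear
   part by replacing [P] by [P - om * (s1, s2)], where [s1] and [s2] are the signs
   of [D1] and [D2]; [om] is so small that the strict inequalities persist. *)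
pose del := - (dt phi z + Hamiltonian c P).
have del0 : 0 < del by rewrite oppr_gt0.
(* The bound of [perturbed_Hamiltonian] plus 1 for the time part [om * h] of the expansion error. *)
pose K1 := 2 * `|P.1| + 2 * `|P.2| + 2 + c + 1.
pose K2 := 2 * a * `|P.1| + a + b + 1.
have aP : 0 <= 2 * a * `|P.1| by rewrite !mulr_ge0// ltW.
have K10 : 0 < K1.
  by have := c_gt0; have := normr_ge0 P.1; have := normr_ge0 P.2; rewrite /K1; lra.
have K20 : 0 < K2 by have := a_gt0; have := b_gt0; rewrite /K2; lra.
have [om [om0 om1 omK omB]] : exists om, [/\ 0 < om, om <= 1, om * K1 <= del / 2 &
    z.1.2 = 0 -> road a b P + om * K2 <= 0].
  have [z0|z0] := eqVneq z.1.2 0; last first.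
    exists (Num.min 1 (del / 2 / K1)); split => //.
    - by rewrite lt_min ltr01 !divr_gt0.
    - by rewrite ge_min lexx.
    - by rewrite -ler_pdivlMr// ge_min lexx orbT.
    - by move=> z00; rewrite z00 eqxx in z0.
  have B1 : 0 < - road a b P by rewrite oppr_gt0 B0.
  exists (Num.min 1 (Num.min (del / 2 / K1) (- road a b P / K2))); split => //.
  - by rewrite !lt_min ltr01 !divr_gt0.
  - by rewrite ge_min lexx.
  - by rewrite -ler_pdivlMr// !ge_min lexx !orbT.
  - move=> _; rewrite -lerBrDl sub0r -ler_pdivlMr//.
    by rewrite !ge_min lexx !orbT.
have [r1 r10 Hr1] := C1_differentiable C1phi zS om0.
(* For a contact point off the road, [r <= z.1.2] keeps the path off the road, so [l] vanishes up to
   time [h]. *)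
have [r [r0 rr1 rz]] : exists r, [/\ 0 < r, r <= r1 & z.1.2 <> 0 -> r <= z.1.2].
  have [z0|z0] := eqVneq z.1.2 0; first by exists r1.
  exists (Num.min r1 z.1.2); split.
  - by rewrite lt_min r10 lt_neqAle eq_sym z0.
  - by rewrite ge_min lexx.
  - by rewrite ge_min lexx orbT.
have W0 : 0 <= W z.1 z.2 by apply: path_value_ge0 => //; exact: ltW.
(* Leaving the ball of radius [r] would require cost plus [C * h] at least [kap * r = W + 2],
   whereas the cost is at most [W + 1 / 2] and [C * h < 1]. *)
pose kap := (W z.1 z.2 + 2) / r.
have kap0 : 0 < kap by rewrite divr_gt0// ltr_wpDl.
have [C C0 disp] := displacement_bound a_gt0 b_gt0 c_gt0 (ltW kap0).
pose h := Num.min (z.2 / 2) (Num.min (r / 2) (C + 1)^-1).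
have C1 : 0 < C + 1 by rewrite ltr_wpDl.
have h0 : 0 < h by rewrite !lt_min !divr_gt0// invr_gt0 C1.
have [h1 h2 h3] : [/\ h <= z.2 / 2, h <= r / 2 & h <= (C + 1)^-1].
  by split; rewrite /h !ge_min lexx ?orbT.
have ht : h < z.2 by lra.
have hr : h < r by lra.
have Ch : C * h < 1.
  have : h * (C + 1) <= 1 by rewrite -ler_pdivlMr// div1r.
  lra.
have dh : 0 < del * h by rewrite mulr_gt0.
(* The strict inequality gains [del * h], of which [om] consumes half; an optimality defect of a
   quarter leaves a contradiction. *)
pose eps := Num.min (1 / 2) (del * h / 4).
have eps0 : 0 < eps by rewrite lt_min !divr_gt0.
have [eps1 eps2] : eps <= 1 / 2 /\ eps <= del * h / 4.
  by split; rewrite /eps !ge_min lexx ?orbT.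
have [|gamma [eta [l [con ik H1 H2]]]] := @path_value_lt _ a b c g0 g0_gt0 z.1 z.2
  (W z.1 z.2 + eps) zh (ltW zt); first by rewrite ltrDl.
have [[_ hp gx] _] := con.
have close s : 0 <= s -> s <= h -> `|gamma s - z.1| < r.
  move=> s0 sh; have st : s <= z.2 by exact: le_trans sh (ltW ht).
  have := disp z.1 z.2 gamma eta l 0 s (lexx 0) s0 st con ik.
  rewrite gx subr0 => D.
  rewrite -(ltr_pM2l kap0) (_ : kap * r = W z.1 z.2 + 2); last first.
    by rewrite /kap divfK// gt_eqF.
  apply: le_lt_trans D _.
  have : \int[mu]_(r in `[0, s]) cost gamma eta l r <= W z.1 z.2 + eps.
    by apply: H1; rewrite s0.
  have : C * s <= C * h by rewrite ler_wpM2l.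
  lra.
have close1 s : 0 <= s -> s <= h -> `|(gamma s).1 - z.1.1| < r /\
    `|(gamma s).2 - z.1.2| < r.
  by move=> s0 sh; have := close s s0 sh; rewrite prod_normE gt_max => /andP[].
have hh : half_plane R (gamma h) by apply: hp; rewrite (ltW h0) ltW.
pose D1 := (gamma h).1 - z.1.1; pose D2 := (gamma h).2 - z.1.2.
have sgn (D : R) : exists2 s : R, `|s| = 1 & s * D = `|D|.
  have [D0|D0] := leP 0 D.
    by exists 1; rewrite ?normr1 ?mul1r// ger0_norm.
  by exists (- 1); rewrite ?normrN1// mulN1r ltr0_norm.
have [s1 n1 sD1] := sgn D1; have [s2 n2 sD2] := sgn D2.
pose P' : R * R := (P.1 - om * s1, P.2 - om * s2).
have HP' := perturbed_Hamiltonian P (ltW om0) om1 n1 n2; rewrite -/P' in HP'.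
have RP' := perturbed_road P (ltW om0) om1 n1 n2; rewrite -/P' -/K2 in RP'.
have hle0 : 0 <= h by exact: ltW.
have dual := @control_duality _ a b c z.1 z.2 gamma eta l 0 h P'
  (- Hamiltonian c P') (lexx 0) hle0 (ltW ht) con ik.
have {dual} := dual _; rewrite gx subr0 -/D1 -/D2 => dual.
have {dual} dual : - Hamiltonian c P' * h <=
    \int[mu]_(s in `[0, h]) cost gamma eta l s + P'.1 * D1 + P'.2 * D2.
  apply: dual => s p /andP[ss0 ssh] dg l0 lE lN _ lg.
  have := @running_cost_fenchel _ a b c a_gt0 gamma eta l s P' p dg l0 lE lN.
  apply: le_trans.
  rewrite lerDl oppr_ge0.
  have [->|ls] := eqVneq (l s) 0; first by rewrite mul0r.
  have gs0 : (gamma s).2 = 0 by apply: lg; exact/eqP.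
  rewrite mulr_ge0_le0//; apply: le_trans RP' _; apply: omB.
  apply: contrapT => zn0; have [_] := close1 s (ltW ss0) (ltW ssh).
  rewrite gs0 sub0r normrN ger0_norm//; have := rz zn0; lra.
have tail := level_tail hle0 (ltW ht) con ik H1 H2.
pose w : R * R * R := (gamma h, z.2 - h).
have wS : space_time R w by split => //=; rewrite subr_gt0.
have := zmin w wS; rewrite /= => M.
have [c1 c2] := close1 h hle0 (lexx h).
have w3 : w.2 - z.2 = - h by rewrite /w /= addrC addKr.
have w3r : `|w.2 - z.2| < r1.
  by rewrite w3 normrN ger0_norm//; exact: lt_le_trans rr1.
have := Hr1 w wS (lt_le_trans c1 rr1) (lt_le_trans c2 rr1) w3r.
rewrite w3 normrN (ger0_norm hle0) /w /= -/D1 -/D2.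
rewrite ler_norml => /andP[D _].
have expand : P'.1 * D1 + P'.2 * D2 =
    P.1 * D1 + P.2 * D2 - om * (`|D1| + `|D2|).
  by rewrite -sD1 -sD2 /P' /=; ring.
have omKh : om * K1 * h <= del / 2 * h by rewrite ler_pM2r.
have HP'h : Hamiltonian c P' * h <=
    (Hamiltonian c P + om * (2 * `|P.1| + 2 * `|P.2| + 2 + c)) * h by rewrite ler_pM2r.
have delh : del * h = - (dt phi z * h) - Hamiltonian c P * h by rewrite /del; ring.
have K1h : om * K1 * h = om * (2 * `|P.1| + 2 * `|P.2| + 2 + c) * h + om * h.
  by rewrite /K1; ring.
move: M D tail dual; rewrite /w /=.
set I := \int[mu]_(s in `[0, h]) _; set V := W (gamma h) _; set F := phi (gamma h, _).
rewrite -[dx phi z]/P.1 -[dy phi z]/P.2.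
set Q := dt phi z in delh *; move: expand omKh HP'h delh K1h eps2 dh.
set X1 := P'.1 * D1; set X2 := P'.2 * D2; set Y1 := P.1 * D1; set Y2 := P.2 * D2.
lra.
Qed.

End viscosity.

(** * Continuity and initial values *)

Section regularity.
Context {R : realType}.
Variables (a b c : R) (g0 : R * R -> R).
Hypotheses (a_gt0 : 0 < a) (b_gt0 : 0 < b) (c_gt0 : 0 < c).
Hypothesis g0_gt0 : forall x, half_plane R x -> 0 < g0 x.
Variable Lip : R.
Hypothesis Lip_ge0 : 0 <= Lip.
Hypothesis g0_Lip : forall x y, half_plane R x -> half_plane R y ->
  `|g0 x - g0 y| <= Lip * `|x - y|.
Local Notation W := (path_value a b c g0).

Lemma path_value_continuous :
  {within space_time R, continuous (fun z : R * R * R => W z.1 z.2)}.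
Proof.
have [C1 C10 H1] := path_value_time a_gt0 b_gt0 c_gt0 g0_gt0 Lip_ge0 g0_Lip.
have [C2 C20 H2] := path_value_space a_gt0 b_gt0 c_gt0 g0_gt0 Lip_ge0 g0_Lip.
apply/subspace_continuousP => -[x t] [/= hx t0]; apply/cvgrPdist_lt => e e0.
pose K := C1 + C2 + 1; have K0 : 0 < K by rewrite ltr_wpDl// addr_ge0.
(* The radius [t / 2] keeps the spatial distance below both times, as [path_value_space]
   requires. *)
have rt : 0 < Num.min (t / 2) (e / K) by rewrite lt_min !divr_gt0.
rewrite near_withinE; apply/nbhs_ballP; exists (Num.min (t / 2) (e / K)) => //=.
move=> [x' t'] [/= xx' tt'] [/= hx' t'0].
move: xx' tt'; rewrite -ball_normE /ball /= !lt_min distrC.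
move=> /andP[x1 x2] /andP[t1 t2].
set d := `|x' - x| in x1 x2; set s := `|t - t'| in t1 t2.
have dt' : d <= t'.
  have : t - t' <= s by exact: ler_norm.
  lra.
have dt : d <= t by lra.
have := H2 x' x t' hx' hx; rewrite distrC -/d => /(_ dt') U1.
have := H2 x x' t' hx hx' dt'; rewrite -/d => U2.
have T : `|W x t - W x t'| <= C1 * s.
  have [tle|tlt] := leP t t'.
    have := H1 x t (t' - t) hx (ltW t0); rewrite subr_ge0 => /(_ tle).
    by rewrite (addrC t) subrK distrC /s (distrC t t') [`|t' - t|]ger0_norm ?subr_ge0.
  have := H1 x t' (t - t') hx (ltW t'0); rewrite subr_ge0 => /(_ (ltW tlt)).
  by rewrite (addrC t') subrK /s [`|t - t'|]gtr0_norm ?subr_gt0.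
have eK : e = K * (e / K) by rewrite mulrC divfK// gt_eqF.
have d0 : 0 <= d by exact: normr_ge0.
have s0 : 0 <= s by exact: normr_ge0.
have q1 : C1 * s <= C1 * (e / K) by rewrite ler_wpM2l// ltW.
have q2 : C2 * d <= C2 * (e / K) by rewrite ler_wpM2l// ltW.
have eK0 : 0 < e / K by rewrite divr_gt0.
have eK' : e = C1 * (e / K) + C2 * (e / K) + e / K by rewrite {1}eK /K; ring.
move: T; rewrite ler_norml => /andP[T1 T2].
rewrite [ltRHS]eK' ltr_norml; apply/andP; split; lra.
Qed.

Lemma path_value_initial x : half_plane R x ->
  W x t @[t --> 0^'+] --> g0 x.
Proof.
move=> hx.
have [C C0 H] := path_value_time a_gt0 b_gt0 c_gt0 g0_gt0 Lip_ge0 g0_Lip.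
apply/cvgrPdist_lt => e e0; near=> t.
have t0 : 0 < t by near: t; exact: nbhs_right_gt.
have := H x 0 t hx (lexx _) (ltW t0); rewrite add0r path_value0// distrC.
move=> /le_lt_trans; apply.
have : t < e / (C + 1).
  by near: t; apply: nbhs_right_lt; rewrite divr_gt0// ltr_wpDl.
rewrite ltr_pdivlMr ?ltr_wpDl// => tC; apply: le_lt_trans tC.
by rewrite mulrC ler_pM2l// lerDl.
Unshelve. all: by end_near. Qed.

End regularity.

Lemma lipschitz_half_plane (R : realType) (g0 : R * R -> R) :
  [lipschitz g0 x | x in half_plane R] -> exists2 Lip : R, 0 <= Lip &
  forall x y, half_plane R x -> half_plane R y ->
    `|g0 x - g0 y| <= Lip * `|x - y|.
Proof.
move=> [M [_ H]]; exists (`|M| + 1); first by rewrite addr_ge0.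
move=> x y hx hy; have := H (`|M| + 1) _ (x, y); apply => //.
by apply: le_lt_trans (ler_norm M) _; rewrite ltrDl.
Qed.

Lemma within_lower_semicontinuous (R : realType) (A : set (R * R * R))
  (f : R * R * R -> R) : {within A, continuous f} ->
  lower_semicontinuous (fun z : subspace A => (f z)%:E).
Proof.
move=> fc z m; rewrite lte_fin => mf.
exists [set w : subspace A | m < f w]; last by move=> w; rewrite lte_fin.
have fz : f w @[w --> (z : subspace A)] --> f z := fc z.
exact: cvgr_gt fz m mf.
Qed.

Unset Implicit Arguments.

Theorem theorem1 (R : realType) (a b c : R) (g0 : R * R -> R)
  (a_gt0 : 0 < a) (b_gt0 : 0 < b) (c_gt0 : 0 < c)
  (g0_gt0 : forall x, half_plane R x -> 0 < g0 x)
  (g0_bounded : [bounded g0 x | x in half_plane R])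
  (g0_lipschitz : [lipschitz g0 x | x in half_plane R]) :
  let I := fun z : R * R * R => fine (upper_value a b c g0 z.1 z.2) in
  [/\ forall x t, half_plane R x -> 0 < t ->
        upper_value a b c g0 x t \is a fin_num,
      {within space_time R, continuous I},
      viscosity_solution a b c g0 I &
      forall x, half_plane R x -> I (x, t) @[t --> 0^'+] --> g0 x].
Proof.
move=> I; have [Lip Lip0 gL] := lipschitz_half_plane g0_lipschitz.
have UE := @upper_valueE R a b c g0 a_gt0 g0_gt0.
(* Time 0 is included, so the initial condition holds for [I] itself and not only in the limit. *)
have IE x t : half_plane R x -> 0 <= t -> I (x, t) = path_value a b c g0 x t.
  by move=> hx t0; rewrite /I /= UE.
have IW z : space_time R z -> I z = path_value a b c g0 z.1 z.2.
  by case: z => x t [hx t0]; rewrite IE//= ltW.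
have Ic : {within space_time R, continuous I}.
  have := path_value_continuous a_gt0 b_gt0 c_gt0 g0_gt0 Lip0 gL.
  apply: subspace_eq_continuous => z /set_mem zS.
  by rewrite /from_subspace IW.
split => //.
- by move=> x t hx t0; rewrite UE// ltW.
- split.
  + split.
      apply: within_lower_semicontinuous => z; apply: continuousN; exact: Ic.
    move=> phi z C1phi [zS zmax] Iz; apply: (subsolution_test a_gt0 g0_gt0 C1phi zS).
      by rewrite -IW.
    move=> w wS; rewrite -!IW//; have [->//|/eqP wz] := eqVneq w z.
    exact/ltW/(zmax w wS wz).
  + split.
    * exact: within_lower_semicontinuous.
    * by move=> z zS; rewrite IW//; case: zS => hz t0; apply: path_value_ge0 => //; exact: ltW.
    * move=> phi z C1phi [zS zmin].
      have zmin' w : space_time R w -> path_value a b c g0 z.1 z.2 - phi z <=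
          path_value a b c g0 w.1 w.2 - phi w.
        move=> wS; rewrite -!IW//; have [->//|/eqP wz] := eqVneq w z.
        exact/ltW/(zmin w wS wz).
      have test := supersolution_test a_gt0 b_gt0 c_gt0 g0_gt0 C1phi zS zmin'.
      split=> z0; rewrite leNgt; apply/negP.
        by move=> /test; apply => z00; rewrite z00 eqxx in z0.
      by rewrite gt_max => /andP[/test T /(fun B => T (fun=> B))].
  + by move=> x hx; rewrite IE// path_value0.
- move=> x hx; have := path_value_initial a_gt0 b_gt0 c_gt0 g0_gt0 Lip0 gL hx.
  apply: cvg_trans; apply: near_eq_cvg; near=> t.
  by rewrite IE// ltW//; near: t; exact: nbhs_right_gt.
Unshelve. all: by end_near. Qed.
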